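(* Let $tr_{\mathbf{1}}$ be the translation from types and sequents of $\mathrm{L}^\ast_{\mathbf{1}}$ to (generalized) graph sequents defined by $tr_{\mathbf{1}}(p)=p$ for primitive $p$ (of type 2), $tr_{\mathbf{1}}(A/B)=tr_{\mathbf{1}}(A)\div(\$\,tr_{\mathbf{1}}(B))^\bullet$, $tr_{\mathbf{1}}(B\backslash A)=tr_{\mathbf{1}}(A)\div(tr_{\mathbf{1}}(B)\,\$)^\bullet$, $tr_{\mathbf{1}}(A\cdot B)=\times((tr_{\mathbf{1}}(A)\,tr_{\mathbf{1}}(B))^\bullet)$, $tr_{\mathbf{1}}(\mathbf{1})=\times(\langle\{v_0\},\emptyset,\emptyset,\emptyset,v_0v_0\rangle)$, and $tr_{\mathbf{1}}(\Gamma\to A)=tr_{\mathbf{1}}(\Gamma)^\bullet\to tr_{\mathbf{1}}(A)$, where for empty $\Gamma$ we set $(\Lambda)^\bullet=\langle\{v_0\},\emptyset,\emptyset,\emptyset,v_0v_0\rangle$. Then for every sequent $\Gamma\to C$ of $\mathrm{L}^\ast_{\mathbf{1}}$: $\mathrm{L}^\ast_{\mathbf{1}}\vdash\Gamma\to C$ if and only if $\mathrm{HL}\vdash tr_{\mathbf{1}}(\Gamma\to C)$.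
   Context: $\mathrm{L}^\ast_{\mathbf{1}}$ (Lambek calculus with unit): types are built from primitive types and the constant $\mathbf{1}$ by $\backslash,/,\cdot$. Sequents $\Gamma\to A$ with $\Gamma$ a possibly empty sequence of types. Axioms $p\to p$ and $\to\mathbf{1}$. Rules (all sequences may be empty): from $\Pi\to A$ and $\Gamma,B,\Delta\to C$ infer $\Gamma,\Pi,A\backslash B,\Delta\to C$; from $A,\Pi\to B$ infer $\Pi\to A\backslash B$; from $\Gamma,A,B,\Delta\to C$ infer $\Gamma,A\cdot B,\Delta\to C$; from $\Pi\to A$ and $\Gamma,B,\Delta\to C$ infer $\Gamma,B/A,\Pi,\Delta\to C$; from $\Pi,A\to B$ infer $\Pi\to B/A$; from $\Pi\to A$ and $\Psi\to B$ infer $\Pi,\Psi\to A\cdot B$; from $\Gamma,\Delta\to A$ infer $\Gamma,\mathbf{1},\Delta\to A$. Generalized hypergraphs (used in this theorem, allowing coincidences): given labels $C$ with $type:C\to\mathbb{N}$, a graph is $G=\langle V,E,att,lab,ext\rangle$ with finite $V,E$, $att:E\to V^\ast$, $lab:E\to C$ with $type(lab(e))=|att(e)|$, and $ext\in V^\ast$ (repetitions of nodes allowed in $att(e)$ and $ext$); $type(G)=|ext|$; isomorphic graphs identified. Handle $a^\bullet$: one edge labeled $a$ attached to $v_1\dots v_n$, all external in that order. String graph $w^\bullet$ of $w=a_1\dots a_n$, $n\ge1$: nodes $v_0,\dots,v_n$, edges $e_i$ with $att(e_i)=v_{i-1}v_i$, $lab(e_i)=a_i$, $ext=v_0v_n$.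 Replacement $G[e/H]$ ($type(e)=type(H)$): remove $e$, insert a disjoint copy of $H$, and for each $i$ identify the $i$-th external node of $H$ with the $i$-th attachment node of $e$; simultaneous replacement $G[e_1/H_1,\dots]$; relabeling $G[e:=a]$. $\mathrm{HL}$ (over these generalized graphs): primitive types $Pr$ with arities (infinitely many of each arity); symbol $\$$ of any arity. Types: primitives; $N\div D$ where $D$ has exactly one edge $d_0$ labeled $\$$, others labeled by types, $type(N)=type(D)$, $type(N\div D)=type_D(d_0)$; $\times(M)$ for a type-labeled graph $M$, $type(\times(M))=type(M)$. Graph sequent $H\to A$ with $type(H)=type(A)$. Axioms $p^\bullet\to p$. Rules: $(\div\to)$ from $H\to A$, $H_i\to lab(d_i)$ ($E_D=\{d_0,\dots,d_k\}$) and $e\in E_H$ labeled $N$ infer $H[e/D][d_0:=N\div D][d_1/H_1,\dots,d_k/H_k]\to A$; $(\to\div)$ from $D[d_0/F]\to N$ infer $F\to N\div D$; $(\times\to)$ from $G[e/F]\to A$ infer $G\to A$ where $e$ is labeled $\times(F)$; $(\to\times)$ from $H_i\to lab(m_i)$ ($E_M=\{m_1,\dots,m_l\}$, $l\ge0$) infer $M[m_1/H_1,\dots,m_l/H_l]\to\times(M)$. *)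

(* Defs.v *)
From mathcomp Require Import all_boot.
From Stdlib Require Import Permutation.

Set Implicit Arguments.
Unset Strict Implicit.
Unset Printing Implicit Defensive.

(* LLeft A B  is  A \ B ;  LRight B A  is  B / A ;  LProd A B is A . B *)
Inductive ltype : Type :=
| LPrim  : nat -> ltype
| LOne   : ltype
| LLeft  : ltype -> ltype -> ltype
| LRight : ltype -> ltype -> ltype
| LProd  : ltype -> ltype -> ltype.

Inductive lder : seq ltype -> ltype -> Prop :=
| L_ax (p : nat) : lder [:: LPrim p] (LPrim p)
| L_oneR : lder [::] LOne
| L_leftL (Pi Gm Dl : seq ltype) (A B C : ltype) :
    lder Pi A -> lder (Gm ++ B :: Dl) C ->
    lder (Gm ++ Pi ++ LLeft A B :: Dl) C
| L_leftR (Pi : seq ltype) (A B : ltype) :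
    lder (A :: Pi) B -> lder Pi (LLeft A B)
| L_prodL (Gm Dl : seq ltype) (A B C : ltype) :
    lder (Gm ++ A :: B :: Dl) C -> lder (Gm ++ LProd A B :: Dl) C
| L_rightL (Pi Gm Dl : seq ltype) (A B C : ltype) :
    lder Pi A -> lder (Gm ++ B :: Dl) C ->
    lder (Gm ++ LRight B A :: Pi ++ Dl) C
| L_rightR (Pi : seq ltype) (A B : ltype) :
    lder (rcons Pi A) B -> lder Pi (LRight B A)
| L_prodR (Pi Psi : seq ltype) (A B : ltype) :
    lder Pi A -> lder Psi B -> lder (Pi ++ Psi) (LProd A B)
| L_oneL (Gm Dl : seq ltype) (A : ltype) :
    lder (Gm ++ Dl) A -> lder (Gm ++ LOne :: Dl) A.

(* Nodes are 0 .. nv-1; an edge is (label, attachment sequence);       *)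
(* repetitions in attachments / external sequence are allowed.         *)

Record graph (L : Type) := Graph {
  nv : nat;
  edges : seq (L * seq nat);
  ext : seq nat }.
Arguments Graph {L}.

Definition nodes_ok L (G : graph L) : Prop :=
  (forall e, List.In e (edges G) -> forall v, List.In v e.2 -> v < nv G) /\
  (forall v, List.In v (ext G) -> v < nv G).

Definition map_nodes L (f : nat -> nat) (n : nat) (G : graph L) : graph L :=
  Graph n [seq (e.1, map f e.2) | e <- edges G] (map f (ext G)).

Definition map_lab L L' (f : L -> L') (G : graph L) : graph L' :=
  Graph (nv G) [seq (f e.1, e.2) | e <- edges G] (ext G).

Definition mrg (a b x : nat) : nat :=
  if a == b then x else
  if x == maxn a b then minn a b else
  if maxn a b < x then x.-1 else x.

Definition merge_graph L (a b : nat) (G : graph L) : graph L :=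
  map_nodes (mrg a b) (if a == b then nv G else (nv G).-1) G.

(* quotient of G by the equivalence generated by the pairs ps *)
Fixpoint gl L (f : nat -> nat) (G : graph L) (ps : seq (nat * nat)) : graph L :=
  match ps with
  | [::] => G
  | p :: ps' =>
      let a := f p.1 in let b := f p.2 in
      gl (mrg a b \o f) (merge_graph a b G) ps'
  end.

Definition glue L (G : graph L) (ps : seq (nat * nat)) : graph L := gl id G ps.

Definition eatt L (G : graph L) (i : nat) : seq nat :=
  nth [::] [seq e.2 | e <- edges G] i.

Definition shift_edge L (n : nat) (e : L * seq nat) : L * seq nat :=
  (e.1, [seq n + v | v <- e.2]).

Fixpoint subst_aux L (attG : nat -> seq nat) (n : nat)
    (rs : seq (nat * graph L)) : nat * seq (L * seq nat) * seq (nat * nat) :=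
  match rs with
  | [::] => (0, [::], [::])
  | (i, H) :: rs' =>
      let '(m, es, ps) := subst_aux attG (n + nv H) rs' in
      (nv H + m,
       [seq shift_edge n e | e <- edges H] ++ es,
       zip [seq n + v | v <- ext H] (attG i) ++ ps)
  end.

(* simultaneous replacement  G[e_1/H_1, ..., e_k/H_k]  (edge indices e_i,
   pairwise distinct).  The remaining edges of G come first (in order),
   followed by the edges of H_1, ..., H_k (in order). *)
Definition subst L (G : graph L) (rs : seq (nat * graph L)) : graph L :=
  let kept := [seq p.1 | p <- zip (edges G) (iota 0 (size (edges G)))
                        & p.2 \notin unzip1 rs] in
  let '(m, es, ps) := subst_aux (eatt G) (nv G) rs in
  glue (Graph (nv G + m) (kept ++ es) (ext G)) ps.

Definition giso L (G G' : graph L) : Prop :=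
  nv G = nv G' /\
  exists f : nat -> nat,
    (forall x, x < nv G -> f x < nv G) /\
    (forall x y, x < nv G -> y < nv G -> f x = f y -> x = y) /\
    Permutation (edges G') [seq (e.1, map f e.2) | e <- edges G] /\
    ext G' = map f (ext G).

Definition handle L (a : L) (n : nat) : graph L :=
  Graph n [:: (a, iota 0 n)] (iota 0 n).

(* string graph w^. ; for empty w this is <{v0}, {}, {}, {}, v0 v0> *)
Definition strg L (w : seq L) : graph L :=
  Graph (size w).+1
        [seq (p.1, [:: p.2; p.2.+1]) | p <- zip w (iota 0 (size w))]
        [:: 0; size w].

(* HL types.  Prim p n : primitive type number p of arity n;           *)
(* Div N D : N ÷ D, where D is labelled by option ty (None = $);       *)

Inductive ty : Type :=
| Prim  : nat -> nat -> ty
| Div   : ty -> graph (option ty) -> ty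
| Times : graph ty -> ty.

Definition isNone (e : option ty * seq nat) : bool :=
  if e.1 is None then true else false.

Definition didx (D : graph (option ty)) : nat := find isNone (edges D).

Definition arity (t : ty) : nat :=
  match t with
  | Prim _ n => n
  | Div _ D => size (eatt D (didx D))
  | Times M => size (ext M)
  end.

Fixpoint wf_ty (t : ty) : Prop :=
  match t with
  | Prim _ _ => True
  | Div N D =>
      wf_ty N /\ nodes_ok D /\ count isNone (edges D) = 1 /\
      arity N = size (ext D) /\
      (fix wfe (es : seq (option ty * seq nat)) : Prop :=
         match es with
         | [::] => True
         | (o, a) :: es' =>
             match o with
             | None => True
             | Some t' => wf_ty t' /\ arity t' = size a
             end /\ wfe es'
         end) (edges D)
  | Times M =>
      nodes_ok M /\
      (fix wfe (es : seq (ty * seq nat)) : Prop :=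
         match es with
         | [::] => True
         | (t', a) :: es' => (wf_ty t' /\ arity t' = size a) /\ wfe es'
         end) (edges M)
  end.

Definition wf_graph (G : graph ty) : Prop :=
  nodes_ok G /\
  forall e, List.In e (edges G) -> wf_ty e.1 /\ arity e.1 = size e.2.

Definition wf_sequent (H : graph ty) (A : ty) : Prop :=
  wf_graph H /\ wf_ty A /\ size (ext H) = arity A.

Definition elab (G : graph ty) (i : nat) : ty :=
  (nth (Prim 0 0, [::]) (edges G) i).1.

Inductive hl_der : graph ty -> ty -> Prop :=
| HL_ax (p n : nat) : hl_der (handle (Prim p n) n) (Prim p n)
| HL_divL (H : graph ty) (A N : ty) (D : graph (option ty)) (e : nat)
    (Hs : nat -> graph ty) :
    hl_der H A ->
    e < size (edges H) -> elab H e = N ->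
    wf_ty (Div N D) ->
    (forall j t, j < size (edges D) ->
        (nth (None, [::]) (edges D) j).1 = Some t -> hl_der (Hs j) t) ->
    let H' :=
      subst (subst H [:: (e, map_lab (fun o => if o is Some t then t
                                               else Div N D) D)])
            [seq ((size (edges H)).-1 + j, Hs j)
              | j <- iota 0 (size (edges D)) & j != didx D] in
    wf_sequent H' A ->
    hl_der H' A
| HL_divR (F : graph ty) (N : ty) (D : graph (option ty)) :
    hl_der (subst (map_lab (fun o => if o is Some t then t else N) D)
                  [:: (didx D, F)]) N ->
    wf_sequent F (Div N D) ->
    hl_der F (Div N D)
| HL_timesL (G F : graph ty) (A : ty) (e : nat) :
    e < size (edges G) -> elab G e = Times F ->
    hl_der (subst G [:: (e, F)]) A ->
    wf_sequent G A ->
    hl_der G A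
| HL_timesR (M : graph ty) (Hs : nat -> graph ty) :
    (forall i, i < size (edges M) -> hl_der (Hs i) (elab M i)) ->
    let G := subst M [seq (i, Hs i) | i <- iota 0 (size (edges M))] in
    wf_sequent G (Times M) ->
    hl_der G (Times M)
| HL_iso (G G' : graph ty) (A : ty) :
    hl_der G A -> giso G G' -> hl_der G' A.

Definition unit_graph L : graph L := Graph 1 [::] [:: 0; 0].

Fixpoint tr1 (A : ltype) : ty :=
  match A with
  | LPrim p => Prim p 2
  | LOne => Times (unit_graph ty)
  | LLeft B A' => Div (tr1 A') (strg [:: Some (tr1 B); None])
  | LRight A' B => Div (tr1 A') (strg [:: None; Some (tr1 B)])
  | LProd A' B => Times (strg [:: tr1 A'; tr1 B])
  end.

(* Main.v *)
(* From L*1 to HL, each rule is simulated by its graph counterpart, since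
   replacing an edge of a string graph by a string graph yields a string graph.

   The converse is an induction on the HL derivation showing that when its
   conclusion is a string graph of translated types, so are its premises.
   (HL also derives graphs which are not strings, e.g. with a dangling edge
   labelled by the unit, so this has to start from the conclusion.)  For (× →)
   and (→ ÷) the premise is again a replacement in a string.  For (÷ →), no
   nodes of H are identified by the replacement, and H and H_1 share a single
   node u; numbering the nodes of the resulting string, every edge except the
   N ÷ D one lies wholly in H or wholly in H_1, so that a switch between the two
   can only occur at u or at that edge: H_1 occupies the interval between
   them, and contracting it turns H into a string.  For (→ ×), the two
   components of the string likewise meet at the only node they share. *)
Require Import Defs.
From mathcomp Require Import all_boot.
From mathcomp Require Import zify.
From Stdlib Require Import Permutation.

Set Implicit Arguments.
Unset Strict Implicit.
Unset Printing Implicit Defensive.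

(** * Edge lists, node renamings and permutations *)

Definition map_att L (f : nat -> nat) (es : seq (L * seq nat)) :=
  [seq (e.1, map f e.2) | e <- es].

Definition att_below L n (es : seq (L * seq nat)) :=
  all (fun e => all (fun v => v < n) e.2) es.

(** The edge list of [strg], with a free starting node so that a factor of a word is again a
    path. *)
Definition path_edges L (s : nat) (w : seq L) : seq (L * seq nat) :=
  [seq (p.1, [:: p.2; p.2.+1]) | p <- zip w (iota s (size w))].

Definition rem_at T i (s : seq T) := take i s ++ drop i.+1 s.

Lemma In_cat T (x : T) s t : List.In x (s ++ t) <-> List.In x s \/ List.In x t.
Proof. exact: List.in_app_iff. Qed.

Lemma In_mem (T : eqType) (x : T) s : List.In x s <-> x \in s.
Proof.
elim: s => [|y s IH] //=; rewrite inE; split.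
  by case=> [->|/IH ->]; rewrite ?eqxx ?orbT.
by case/orP => [/eqP ->|/IH]; [left|right].
Qed.

Lemma all_In T (a : pred T) s : all a s <-> forall x, List.In x s -> a x.
Proof.
elim: s => [|y s IH] //=; split.
  by case/andP=> ay /IH h x [<-|/h].
move=> h; apply/andP; split; first by apply: h; left.
by apply/IH => x xs; apply: h; right.
Qed.

Lemma nodes_okE L (G : graph L) :
  nodes_ok G <-> att_below (nv G) (edges G) /\ all (fun v => v < nv G) (ext G).
Proof.
split=> [[h1 h2]|[/all_In h1 /all_In h2]]; split => //.
- by apply/all_In => e /h1 h; apply/all_In.
- exact/all_In.
- by move=> e /h1 /all_In h v /h.
Qed.

Lemma map_att_comp L f g (es : seq (L * seq nat)) :
  map_att f (map_att g es) = map_att (f \o g) es.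
Proof. by rewrite /map_att -map_comp; apply: eq_map => e /=; rewrite -map_comp. Qed.

Lemma map_att_cat L f (es es' : seq (L * seq nat)) :
  map_att f (es ++ es') = map_att f es ++ map_att f es'.
Proof. exact: map_cat. Qed.

Lemma Permutation_map_att L f (es es' : seq (L * seq nat)) :
  Permutation es es' -> Permutation (map_att f es) (map_att f es').
Proof. exact: Permutation_map. Qed.

(* MathComp's [cat] is convertible to, but not syntactically, Stdlib's [app]. *)
Lemma Permutation_cat T (s1 s2 t1 t2 : seq T) :
  Permutation s1 t1 -> Permutation s2 t2 -> Permutation (s1 ++ s2) (t1 ++ t2).
Proof. exact: Permutation_app. Qed.

Lemma Permutation_catC T (s t : seq T) : Permutation (s ++ t) (t ++ s).
Proof. exact: Permutation_app_comm. Qed.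

Lemma eq_map_lt n (f g : nat -> nat) s : all (fun v => v < n) s ->
  (forall x, x < n -> f x = g x) -> map f s = map g s.
Proof. by move=> /allP h fg; apply/eq_in_map => x /h /fg. Qed.

Lemma eq_map_att L n f g (es : seq (L * seq nat)) : att_below n es ->
  (forall x, x < n -> f x = g x) -> map_att f es = map_att g es.
Proof.
move=> + fg; elim: es => [|e es IH] //= /andP[he /IH ->].
by rewrite (eq_map_lt he fg).
Qed.

Lemma att_below_map_att L n m f (es : seq (L * seq nat)) : att_below n es ->
  (forall x, x < n -> f x < m) -> att_below m (map_att f es).
Proof.
move=> + fg; elim: es => [|e es IH] //= /andP[he /IH ->].
by rewrite andbT all_map; apply: sub_all he => x /fg.
Qed.

Lemma att_below_cat L n (es es' : seq (L * seq nat)) :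
  att_below n (es ++ es') = att_below n es && att_below n es'.
Proof. exact: all_cat. Qed.

Lemma att_below_rem_at L n i (es : seq (L * seq nat)) : att_below n es -> att_below n (rem_at i es).
Proof.
rewrite -{1}(cat_take_drop i es) !att_below_cat => /andP[-> /=].
by rewrite -addn1 addnC -drop_drop; case: drop => //= e s /andP[_]; rewrite drop0.
Qed.

Lemma rem_at_split T (d : T) i s : i < size s ->
  s = take i s ++ nth d s i :: drop i.+1 s.
Proof. by move=> h; rewrite -drop_nth // cat_take_drop. Qed.

Lemma size_rem_at T i (s : seq T) : i < size s -> size (rem_at i s) = (size s).-1.
Proof. by move=> h; rewrite size_cat size_takel ?size_drop; lia. Qed.

Lemma map_nodes_id L (G : graph L) : map_nodes id (nv G) G = G.
Proof.
case: G => n es x; rewrite /map_nodes /= map_id; congr Graph.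
by elim: es => [|[l a] es IH] //=; rewrite map_id IH.
Qed.

(** * Gluing as a quotient *)

(** The universal property of one merge: [mrg a b] sends the larger node to the smaller and closes
    the gap, so [g] is read off through the inverse renumbering, which skips [maxn a b]. *)
Lemma mrg_factor a b (g : nat -> nat) : g a = g b ->
  exists g', forall x, g x = g' (mrg a b x).
Proof.
move=> gab; rewrite /mrg; case: eqVneq => [_|ne]; first by exists g.
exists (fun y => if y < maxn a b then g y else g y.+1) => x.
case: eqVneq => [->|nx].
  have -> : minn a b < maxn a b by lia.
  by case: (leqP a b); rewrite gab.
case: (ltnP (maxn a b) x) => h; first by rewrite ifF ?prednK; lia.
by rewrite ifT; lia.
Qed.

Lemma mrg_lt a b n x : a < n -> b < n -> x < n ->
  mrg a b x < if a == b then n else n.-1.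
Proof. by move=> ha hb hx; rewrite /mrg; case: eqVneq => // ?; case: ifP => ?; [|case: ifP => ?]; lia. Qed.

Lemma mrg_surj a b n y : a < n -> b < n -> y < (if a == b then n else n.-1) ->
  exists2 x, x < n & mrg a b x = y.
Proof.
move=> ha hb; rewrite /mrg; case: eqVneq => [_|ne] hy; first by exists y.
case: (ltnP y (maxn a b)) => h.
  by exists y; [|case: ifP; [|case: ifP]]; lia.
by exists y.+1; [|case: ifP; [|case: ifP]]; lia.
Qed.

(* [q] is characterised as the quotient map by its universal property: a map
   constant on every pair of [ps] factors through [q]. *)
Definition quot_map (ps : seq (nat * nat)) (q : nat -> nat) :=
  (forall p, p \in ps -> q p.1 = q p.2) /\
  (forall g : nat -> nat, (forall p, p \in ps -> g p.1 = g p.2) ->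
     exists g', forall x, g x = g' (q x)).

Definition pairs_below n (ps : seq (nat * nat)) := all (fun p => (p.1 < n) && (p.2 < n)) ps.

(** The pairs keep their original numbering, and [f] carries them into the graph merged so far. The
    quotient map is one merge followed by the quotient for the remaining pairs: a map constant on
    all pairs factors through the merge by [mrg_factor], then through the rest by induction. *)
Lemma gl_spec L (f : nat -> nat) (G : graph L) ps :
  pairs_below (nv G) [seq (f p.1, f p.2) | p <- ps] ->
  exists q n, [/\ gl f G ps = map_nodes q n G,
    quot_map [seq (f p.1, f p.2) | p <- ps] q,
    forall x, x < nv G -> q x < n &
    forall y, y < n -> exists2 x, x < nv G & q x = y].
Proof.
elim: ps f G => [|p ps IH] f G /=.
  move=> _; exists id, (nv G); split => //; last by move=> y; exists y.
    by rewrite map_nodes_id.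
  by split=> // g _; exists g.
case/andP => /andP[ha hb] bd.
set a := f p.1 in ha *; set b := f p.2 in hb *.
have [|q [n [e [q1 q2] h1 h2]]] := IH (mrg a b \o f) (merge_graph a b G).
  move: bd; rewrite /pairs_below !all_map; apply: sub_all => r /= /andP[x y].
  by apply/andP; split; apply: mrg_lt.
exists (q \o mrg a b), n; split.
- rewrite e /map_nodes /merge_graph /=; congr Graph; last by rewrite -map_comp.
  exact: map_att_comp.
- split=> [r|g hg].
    rewrite inE => /orP[/eqP -> /=|/mapP[r' r'ps ->] /=].
      by congr q; rewrite /mrg; case: eqVneq => // ?; do 4?[case: ifP => //]; lia.
    exact: (q1 (mrg a b (f r'.1), mrg a b (f r'.2)) (map_f _ r'ps)).
  have [g1 hg1] : exists g', forall x, g x = g' (mrg a b x).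
    by apply: mrg_factor; apply: (hg (a, b)); rewrite inE eqxx.
  have [|g2 hg2] := q2 g1.
    move=> _ /mapP[r rps ->] /=; rewrite -!hg1.
    by apply: (hg (f r.1, f r.2)); rewrite inE map_f ?orbT.
  by exists g2 => x /=; rewrite hg1 hg2.
- by move=> x hx; apply: h1; apply: mrg_lt.
- move=> y /h2[x hx <-]; have [z hz <-] := mrg_surj ha hb hx.
  by exists z.
Qed.

Lemma glue_spec L (G : graph L) ps : pairs_below (nv G) ps ->
  exists q n, [/\ glue G ps = map_nodes q n G, quot_map ps q,
    forall x, x < nv G -> q x < n &
    forall y, y < n -> exists2 x, x < nv G & q x = y].
Proof.
have := @gl_spec L id G ps.
have -> // : [seq (id p.1, id p.2) | p <- ps] = ps.
by rewrite -[RHS]map_id; apply: eq_map => -[].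
Qed.

Lemma subst1E L (G : graph L) i (H : graph L) :
  subst G [:: (i, H)] =
  glue (Graph (nv G + nv H) (rem_at i (edges G) ++ map_att (addn (nv G)) (edges H)) (ext G))
       (zip (map (addn (nv G)) (ext H)) (eatt G i)).
Proof.
rewrite /subst /= addn0 !cats0; congr glue; congr Graph; congr cat.
rewrite /rem_at; move: (edges G) => es.
(* The numbering starts at an arbitrary [s], since it moves on by one at each step of the induction
   on the edges. *)
suff h s : [seq p.1 | p <- zip es (iota s (size es)) & p.2 \notin [:: s + i]] =
  take i es ++ drop i.+1 es by rewrite -(h 0).
have keep n t m : n < m ->
    [seq p.1 | p <- zip t (iota m (size t)) & p.2 \notin [:: n]] = t :> seq (L * seq nat).
  elim: t m => [|e t IH] m //= nm; rewrite inE ifT /= ?IH //; lia.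
elim: es i s => [|e es IH] [|i] s //=; rewrite inE ?addn0 ?eqxx /=.
  by rewrite keep // drop0.
by rewrite ifT /= -?(IH i s.+1) ?addSnnS //; lia.
Qed.

(** * String graphs and replacement *)

(* [f] numbers the nodes of [G] from [0] to [size w] along the string. *)
Definition string_pos L (G : graph L) (w : seq L) (f : nat -> nat) : Prop :=
  [/\ nodes_ok G, (forall x, x < nv G -> f x <= size w),
      (forall x y, x < nv G -> y < nv G -> f x = f y -> x = y),
      Permutation (map_att f (edges G)) (path_edges 0 w) & map f (ext G) = [:: 0; size w]].

Definition is_string L (G : graph L) w := exists f, string_pos G w f.

Lemma path_edges_cat L s (w1 w2 : seq L) : path_edges s (w1 ++ w2) = path_edges s w1 ++ path_edges (s + size w1) w2.
Proof.
elim: w1 s => [|x w1 IH] s; first by rewrite addn0.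
by rewrite /path_edges /= in IH *; rewrite IH addSnnS.
Qed.

Lemma path_edges_cons L s x (w : seq L) : path_edges s (x :: w) = (x, [:: s; s.+1]) :: path_edges s.+1 w.
Proof. by []. Qed.

Lemma size_path_edges L s (w : seq L) : size (path_edges s w) = size w.
Proof. by rewrite size_map size_zip size_iota minnn. Qed.

Lemma map_att_path_edges L s t f (w : seq L) :
  (forall x, s <= x <= s + size w -> f x = x - s + t) -> map_att f (path_edges s w) = path_edges t w.
Proof.
elim: w s t => [|x w IH] s t //; rewrite [size _]/= => h; rewrite !path_edges_cons /= !h; try lia.
congr (_ :: _); first by do ?f_equal; lia.
by apply: IH => y hy; rewrite h; lia.
Qed.

Lemma In_path_edges L s (w : seq L) e : List.In e (path_edges s w) ->
  exists w1 x w2, w = w1 ++ x :: w2 /\ e = (x, [:: s + size w1; (s + size w1).+1]).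
Proof.
elim: w s => [|x w IH] s //; rewrite path_edges_cons => -[<-|/IH[w1 [y [w2 [-> ->]]]]].
  by exists [::], x, w; rewrite addn0.
by exists (x :: w1), y, w2; rewrite /= addnS.
Qed.

Lemma path_edges_In L s (w1 w2 : seq L) x :
  List.In (x, [:: s + size w1; (s + size w1).+1]) (path_edges s (w1 ++ x :: w2)).
Proof. by rewrite path_edges_cat path_edges_cons; apply/In_cat; right; left. Qed.

Lemma cat_inj_size T (a b c d : seq T) : size a = size c -> a ++ b = c ++ d -> a = c /\ b = d.
Proof.
move=> e h; split; first by rewrite -(take_size_cat b e) h take_size_cat.
by rewrite -(drop_size_cat b e) h drop_size_cat.
Qed.

Lemma nth_map_att L f (es : seq (L * seq nat)) d d' i : i < size es ->
  nth d (map_att f es) i = ((nth d' es i).1, map f (nth d' es i).2).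
Proof. exact: nth_map. Qed.

Lemma eattE L (G : graph L) d i : i < size (edges G) -> eatt G i = (nth d (edges G) i).2.
Proof. exact: nth_map. Qed.

Lemma In_nth T (d : T) s i : i < size s -> List.In (nth d s i) s.
Proof. by elim: s i => [|x s IH] [|i] //= h; [left|right; apply: IH]. Qed.

Lemma string_pos_size L (G : graph L) w f : string_pos G w f -> size (edges G) = size w.
Proof.
move=> [_ _ _ pm _]; have : size (map_att f (edges G)) = size (path_edges 0 w).
  exact: Permutation_length pm.
by rewrite size_map size_path_edges.
Qed.

(** The image of the attachment under [f] fixes the place of the label in [w]. Cancelling this edge
    on both sides of the permutation leaves the paths before and after it. *)
Lemma string_pos_split L (G : graph L) w f d i : string_pos G w f -> i < size (edges G) ->
  exists w1 w2, [/\ w = w1 ++ (nth d (edges G) i).1 :: w2,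
    map f (eatt G i) = [:: size w1; (size w1).+1] &
    Permutation (map_att f (rem_at i (edges G))) (path_edges 0 w1 ++ path_edges (size w1).+1 w2)].
Proof.
move=> [_ _ _ pm _] hi.
have : List.In ((nth d (edges G) i).1, map f (eatt G i)) (path_edges 0 w).
  apply: Permutation_in pm _; rewrite (eattE d) //.
  by rewrite -(nth_map_att f d d hi); apply: In_nth; rewrite size_map.
case/In_path_edges => w1 [x [w2 [ew [e1 e2]]]]; rewrite !add0n in e2.
exists w1, w2; rewrite e1; split => //.
move: pm; rewrite {1}(rem_at_split d hi) map_att_cat /= -(eattE d) // e1 e2 ew path_edges_cat path_edges_cons add0n.
by rewrite /rem_at map_att_cat => pm; apply: Permutation_app_inv pm.
Qed.

(** Positions are given before gluing. That [g] identifies nothing beyond the pairs is expressed by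
    test maps: whatever is constant on the pairs is constant on the fibres of [g]. Applied to the
    quotient map, this gives injectivity after gluing. The edge lists agree in order, which lets
    single edges be located. *)
Lemma string_pos_glue L (P : graph L) ps w g :
  nodes_ok P -> pairs_below (nv P) ps ->
  (forall p, p \in ps -> g p.1 = g p.2) ->
  (forall x, x < nv P -> g x <= size w) ->
  (forall q : nat -> nat, (forall p, p \in ps -> q p.1 = q p.2) ->
     forall x y, x < nv P -> y < nv P -> g x = g y -> q x = q y) ->
  Permutation (map_att g (edges P)) (path_edges 0 w) -> map g (ext P) = [:: 0; size w] ->
  exists f, string_pos (glue P ps) w f /\ map_att f (edges (glue P ps)) = map_att g (edges P).
Proof.
move=> /nodes_okE[ok1 ok2] bd hg rg ker pm ex.
have [q [n [-> [q1 q2] hq sq]]] := glue_spec bd.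
have [f hf] := q2 g hg.
have E es : map_att f (map_att q es) = map_att g es :> seq (L * _).
  by rewrite map_att_comp; apply: eq_map => e; congr pair; apply: eq_map => x /=.
exists f; split; last exact: E.
split.
- apply/nodes_okE; split=> /=; first exact: att_below_map_att ok1 hq.
  by rewrite all_map; apply: sub_all ok2 => x /hq.
- by move=> _ /sq[x hx <-]; rewrite -hf; apply: rg.
- move=> _ _ /sq[x hx <-] /sq[y hy <-]; rewrite -!hf; exact: ker.
- by rewrite E.
- by rewrite /= -map_comp -ex; apply: eq_map => x /=.
Qed.

(** Positions are pulled back along the quotient map. A test map [t] that is constant on the pairs
    and separates two nodes shows that these have different positions. *)
Lemma string_pos_glueV L (P : graph L) ps w f :
  pairs_below (nv P) ps -> string_pos (glue P ps) w f ->
  exists g, [/\ forall p, p \in ps -> g p.1 = g p.2,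
   forall x, x < nv P -> g x <= size w,
   forall t : nat -> nat, (forall p, p \in ps -> t p.1 = t p.2) ->
     forall x y, x < nv P -> y < nv P -> g x = g y -> t x = t y,
  Permutation (map_att g (edges P)) (path_edges 0 w) & map g (ext P) = [:: 0; size w]].
Proof.
move=> bd; have [q [n [-> [q1 q2] hq sq]]] := glue_spec bd.
move=> [_ rg inj pm ex]; exists (f \o q); split.
- by move=> p /q1 /= ->.
- by move=> x /hq /rg.
- by move=> t /q2[t' ht] x y hx hy /(inj _ _ (hq _ hx) (hq _ hy)) e; rewrite !ht e.
- by move: pm; rewrite /= [map_att _ _]map_att_comp.
- by move: ex; rewrite /= -map_comp.
Qed.

Lemma map2I (f : nat -> nat) s a b : map f s = [:: a; b] ->
  exists x y, [/\ s = [:: x; y], f x = a & f y = b].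
Proof. by case: s => [|x [|y []]] //= [<- <-]; exists x, y. Qed.

Lemma eatt_lt L (G : graph L) i : att_below (nv G) (edges G) -> i < size (edges G) ->
  all (fun v => v < nv G) (eatt G i).
Proof.
move=> /all_nthP h hi; case E: (edges G) hi => [//|d es]; rewrite -E => hi.
by rewrite (eattE d) //; apply: (h d).
Qed.

(** The positions of [H] are shifted to start at the replaced edge, and those of [G] after that edge
    make room. The second conclusion locates the inserted edges, one of which is itself replaced in
    (÷ →). *)
Lemma string_pos_subst1 L (G H : graph L) w1 x w2 u f h i :
  string_pos G (w1 ++ x :: w2) f -> i < size (edges G) ->
  map f (eatt G i) = [:: size w1; (size w1).+1] -> string_pos H u h ->
  exists f', string_pos (subst G [:: (i, H)]) (w1 ++ u ++ w2) f' /\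
    forall j, j < size (edges H) ->
      map f' (eatt (subst G [:: (i, H)]) ((size (edges G)).-1 + j)) =
      map (addn (size w1)) (map h (eatt H j)).
Proof.
move=> sG hi ai sH.
have [d] : exists d : L * seq nat, True by case: (edges G) hi => [//|d]; exists d.
move=> _.
have [w1' [w2' [ew]]] := string_pos_split d sG hi.
rewrite ai => -[es1 _]; have [] := cat_inj_size es1 ew => <- [_ <-] {w1' w2' ew es1} pm.
case: sG => /nodes_okE[okG okxG] rG iG _ xG; case: sH => /nodes_okE[okH okxH] rH iH pH xH.
have [a [c [eac fa fc]]] := map2I ai.
have [s [t [est hs ht]]] := map2I xH.
have [e1 [e2 [ee fe1 fe2]]] := map2I xG.
have := eatt_lt okG hi; rewrite eac /= => /and3P[la lc _].
move: (okxH); rewrite est /= => /and3P[ls lt _].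
rewrite subst1E est eac.
set k := size w1 in fa fc ai pm *; set m := size u in rH ht *.
(* For empty [u], where [m = 0], this sends [k.+1] to [k]: the ends of the replaced edge are
   merged. *)
pose rel y := if y <= k then y else y + m - 1.
pose g z := if z < nv G then rel (f z) else k + h (z - nv G).
have gG y : y < nv G -> g y = rel (f y) by rewrite /g => ->.
have gH y : g (nv G + y) = k + h y by rewrite /g ltnNge leq_addr addKn.
have EH : map_att g (map_att (addn (nv G)) (edges H)) = map_att (addn k) (map_att h (edges H)).
  rewrite !map_att_comp; apply: eq_map => e; congr pair; apply: eq_map => y /=.
  exact: gH.
have EG : map_att g (rem_at i (edges G)) = map_att rel (map_att f (rem_at i (edges G))).
  rewrite map_att_comp; apply: (@eq_map_att _ (nv G)); last exact: gG.
  exact: att_below_rem_at.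
have [|||||||f' [sf ef]] := @string_pos_glue _
 (Graph (nv G + nv H) (rem_at i (edges G) ++ map_att (addn (nv G)) (edges H)) (ext G))
 [:: (nv G + s, a); (nv G + t, c)] (w1 ++ u ++ w2) g.
- apply/nodes_okE; split=> /=.
    rewrite att_below_cat; apply/andP; split.
      apply: sub_all (att_below_rem_at i okG) => e; apply: sub_all => y; lia.
    by apply: att_below_map_att okH _ => y; lia.
  by apply: sub_all okxG => y; lia.
- by rewrite /pairs_below /= !ltn_add2l ls lt; lia.
- move=> p; rewrite !inE => /orP[] /eqP -> /=; rewrite gH gG // /rel ?hs ?ht ?fa ?fc.
    by rewrite leqnn addn0.
  by rewrite ltnn; lia.
- move=> y /= hy; rewrite !size_cat -/k -/m /g /rel.
  case: ltnP => hyG.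
    have := rG _ hyG; rewrite size_cat /= -/k; case: ifP; lia.
  have : y - nv G < nv H by lia.
  by move/rH; lia.
- move=> q hq.
  have qa : q (nv G + s) = q a by apply: (hq (_, _)); rewrite inE eqxx.
  have qc : q (nv G + t) = q c by apply: (hq (_, _)); rewrite !inE eqxx orbT.
  have fI y z : y < nv G -> z < nv G -> g y = g z -> f y <= f z -> q y = q z.
    move=> hy hz; rewrite !gG // => e le.
    case: (eqVneq (f y) (f z)) => [/(iG _ _ hy hz) -> //|ne].
    (* Distinct positions of [G] collide only for empty [u]; then [s] and [t] are the same node of
       [H], which links [a] to [c]. *)
    have [h1 [h2 h3]] : f y = k /\ f z = k.+1 /\ m = 0.
      by move: e; rewrite /rel; do 2!case: ifP; lia.
    have -> : y = a by apply: iG; rewrite // h1.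
    have -> : z = c by apply: iG; rewrite // h2.
    by rewrite -qa -qc; congr (q (_ + _)); apply: iH => //; rewrite hs ht h3.
  have fH y z : y < nv G -> nv G <= z < nv G + nv H -> g y = g z -> q y = q z.
    move=> hy hz; rewrite gG // /g ltnNge; have [-> hz'] : nv G <= z /\ z - nv G < nv H by lia.
    move=> /= e; have := rH _ hz' => hr.
    have ez : z = nv G + (z - nv G) by lia.
    (* A node of [G] and a node of [H] share a position only at an end of the replaced edge. *)
    have [[h1 h2]|[h1 h2]] : f y = k /\ h (z - nv G) = 0 \/ f y = k.+1 /\ h (z - nv G) = m.
      by move: e; rewrite /rel; case: ifP; lia.
      have -> : y = a by apply: iG; rewrite // h1.
      by rewrite -qa ez; congr (q (_ + _)); apply: iH => //; rewrite hs h2.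
    have -> : y = c by apply: iG; rewrite // h1.
    by rewrite -qc ez; congr (q (_ + _)); apply: iH => //; rewrite ht h2.
  move=> y z /= hy hz e; case: (ltnP y (nv G)) => hy'; case: (ltnP z (nv G)) => hz'.
  + by case/orP: (leq_total (f y) (f z)) => le; [|symmetry]; apply: fI.
  + by apply: fH => //; lia.
  + by symmetry; apply: fH => //; lia.
  + have ez : z = nv G + (z - nv G) by lia.
    have ey : y = nv G + (y - nv G) by lia.
    rewrite ey ez; congr (q (_ + _)); apply: iH; try lia.
    by apply: (@addnI k); rewrite -!gH -ey -ez.
- rewrite map_att_cat EH EG.
  have p1 := Permutation_map_att rel pm.
  have p2 := Permutation_map_att (addn k) pH.
  apply: Permutation_trans (Permutation_cat p1 p2) _.
  rewrite map_att_cat.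
  rewrite (@map_att_path_edges _ 0 0) => [|y hy]; last by rewrite /rel; case: ifP; lia.
  rewrite (@map_att_path_edges _ k.+1 (k + m)) => [|y hy]; last by rewrite /rel; case: ifP; lia.
  rewrite (@map_att_path_edges _ 0 k) => [|y hy]; last by lia.
  rewrite !path_edges_cat add0n -/k -/m -catA.
  exact: Permutation_cat (Permutation_refl _) (Permutation_catC _ _).
- move: okxG; rewrite ee /= => /and3P[l1 l2 _].
  rewrite !gG // fe1 fe2 /rel !size_cat /= -/k -/m; f_equal; f_equal.
  by case: ifP; lia.
exists f'; split=> // j hj.
set G' := glue _ _ in sf ef *.
have sz : size (rem_at i (edges G)) = (size (edges G)).-1 by rewrite size_rem_at.
have szG : size (edges G') = (size (edges G)).-1 + size (edges H).
  by rewrite -[LHS](size_map (fun e => (e.1, map f' e.2))) -[LHS]/(size (map_att _ _)) ef size_map size_cat sz size_map.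
rewrite (eattE d) ?szG ?ltn_add2l //.
have := congr1 (fun l => (nth d l ((size (edges G)).-1 + j)).2) ef.
rewrite /= (nth_map_att f' d d) ?szG ?ltn_add2l //= => ->.
rewrite map_att_cat nth_cat size_map sz ltnNge leq_addr addKn /= EH.
by rewrite (nth_map_att _ d d) ?size_map //= (nth_map_att _ d d) //= (eattE d).
Qed.

Lemma strg2_subst2E L (a b : L) (H0 H1 : graph L) :
  subst (strg [:: a; b]) [:: (0, H0); (1, H1)] =
  glue (Graph (3 + (nv H0 + nv H1))
         (map_att (addn 3) (edges H0) ++ map_att (addn (3 + nv H0)) (edges H1)) [:: 0; 2])
       (zip (map (addn 3) (ext H0)) [:: 0; 1] ++
        zip (map (addn (3 + nv H0)) (ext H1)) [:: 1; 2]).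
Proof. by rewrite /subst /= addn0 !cats0. Qed.

Lemma is_string_times L (a b : L) H0 H1 w0 w1 : is_string H0 w0 -> is_string H1 w1 ->
  is_string (subst (strg [:: a; b]) [:: (0, H0); (1, H1)]) (w0 ++ w1).
Proof.
move=> [h0 [/nodes_okE[ok0 okx0] r0 i0 p0 x0]] [h1 [/nodes_okE[ok1 okx1] r1 i1 p1 x1]].
have [s0 [t0 [e0 hs0 ht0]]] := map2I x0.
have [s1 [t1 [e1 hs1 ht1]]] := map2I x1.
move: okx0 okx1; rewrite strg2_subst2E e0 e1 /= => /and3P[ls0 lt0 _] /and3P[ls1 lt1 _].
set m0 := size w0 in r0 ht0; set m1 := size w1 in r1 ht1.
(* Nodes 0, 1 and 2 are those of the outer string: the start of [H0], the meeting point, and the end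
   of [H1]. *)
pose g z := if z < 3 then nth 0 [:: 0; m0; m0 + m1] z else
  if z < 3 + nv H0 then h0 (z - 3) else m0 + h1 (z - (3 + nv H0)).
have g0 y : y < nv H0 -> g (3 + y) = h0 y.
  by move=> hy; rewrite /g ltnNge leq_addr ltn_add2l hy addKn.
have g1 y : g (3 + nv H0 + y) = m0 + h1 y.
  by rewrite /g !ifF ?addKn //; lia.
have [|||||||f [sf _]] := @string_pos_glue _
 (Graph (3 + (nv H0 + nv H1))
    (map_att (addn 3) (edges H0) ++ map_att (addn (3 + nv H0)) (edges H1)) [:: 0; 2])
 [:: (3 + s0, 0); (3 + t0, 1); (3 + nv H0 + s1, 1); (3 + nv H0 + t1, 2)]
 (w0 ++ w1) g; last by exists f.
- apply/nodes_okE; split=> //=; rewrite att_below_cat.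
  by apply/andP; split; [apply: att_below_map_att ok0 _|apply: att_below_map_att ok1 _] => y; lia.
- by rewrite /pairs_below /=; lia.
- move=> p; rewrite !inE.
  case/or4P => /eqP ->; rewrite [_.1]/= [_.2]/=.
  + by rewrite g0 // hs0.
  + by rewrite g0 // ht0.
  + by rewrite g1 hs1 addn0.
  + by rewrite g1 ht1.
- move=> y /= hy; rewrite size_cat -/m0 -/m1 /g.
  case: ifP => h3; first by case: y h3 {hy} => [|[|[|]]] //= _; lia.
  case: ifP => h4; first by have /r0 : y - 3 < nv H0; lia.
  by have /r1 : y - (3 + nv H0) < nv H1; lia.
- move=> q hq.
  have [q1 q2 q3 q4] : [/\ q (3 + s0) = q 0, q (3 + t0) = q 1,
      q (3 + nv H0 + s1) = q 1 & q (3 + nv H0 + t1) = q 2].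
    by split; apply: (hq (_, _)); rewrite !inE eqxx ?orbT.
  (* Each outer node is glued to an end of [H0] or [H1], so only nodes of the two components remain
     to be compared. *)
  have rep y : y < 3 + (nv H0 + nv H1) -> exists z, q y = q z /\ g y = g z /\
     ((exists2 z', z = 3 + z' & z' < nv H0) \/
      (exists2 z', z = 3 + nv H0 + z' & z' < nv H1)).
    case: (ltnP y 3) => [h3 _|h3 h4].
      case: y h3 => [|[|[|]]] // _.
      - exists (3 + s0); rewrite g0 // hs0; do 2!split=> //; by left; exists s0.
      - exists (3 + t0); rewrite g0 // ht0; do 2!split=> //; by left; exists t0.
      - exists (3 + nv H0 + t1); rewrite g1 ht1; do 2!split=> //; by right; exists t1.
    exists y; do 2!split=> //; case: (ltnP y (3 + nv H0)) => h5.
      by left; exists (y - 3); lia.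
    by right; exists (y - (3 + nv H0)); lia.
  (* A position common to both components is [m0], where [t0] and [s1] are both glued to node 1. *)
  have X y z : y < nv H0 -> z < nv H1 -> g (3 + y) = g (3 + nv H0 + z) ->
      q (3 + y) = q (3 + nv H0 + z).
    move=> hy hz; rewrite g0 // g1 => e; have := r0 _ hy => le.
    have -> : y = t0 by apply: i0; rewrite ?ht0 //; lia.
    by have -> : z = s1 by [apply: i1; rewrite ?hs1 //; lia]; rewrite q2 q3.
  move=> y z /rep[y' [-> [-> hy]]] /rep[z' [-> [-> hz]]].
  case: hy => -[y1 -> hy]; case: hz => -[z1 -> hz].
  + by rewrite !g0 // => e; congr (q (_ + _)); apply: i0.
  + exact: X.
  + by move=> e; symmetry; apply: X.
  + by rewrite !g1 => /addnI e; congr (q (_ + _)); apply: i1.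
- rewrite map_att_cat !map_att_comp path_edges_cat add0n; apply: Permutation_cat.
    suff -> : map_att (g \o addn 3) (edges H0) = map_att h0 (edges H0) by [].
    by apply: eq_map_att ok0 _ => y /g0.
  have -> : map_att (g \o addn (3 + nv H0)) (edges H1) = map_att (addn m0) (map_att h1 (edges H1)).
    by rewrite map_att_comp; apply: eq_map_att ok1 _ => y _ /=; rewrite g1.
  apply: Permutation_trans (Permutation_map_att _ p1) _.
  by rewrite (@map_att_path_edges _ 0 m0) // => y; lia.
- by rewrite /= size_cat.
Qed.

(** * Standard string graphs and isomorphism *)

Lemma string_pos_strg L (w : seq L) : string_pos (strg w) w id.
Proof.
have E : map_att id (path_edges 0 w) = path_edges 0 w by apply: map_att_path_edges; lia.
split=> //; [|by rewrite -/(path_edges 0 w) E].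
apply/nodes_okE; split=> /=; last by rewrite ltnSn.
apply/all_In => e /In_path_edges[w1 [x [w2 [-> ->]]]] /=; rewrite size_cat /=; lia.
Qed.

Lemma is_string_iso L (G G' : graph L) w :
  nodes_ok G -> giso G G' -> is_string G' w -> is_string G w.
Proof.
move=> ok [en [f [rf [jf [pm ex]]]]] [h [_ r i p x]]; exists (h \o f); split=> //.
- by move=> y /rf; rewrite en => /r.
- by move=> y z hy hz /i e; apply: jf => //; apply: e; rewrite -en; apply: rf.
- rewrite -map_att_comp; apply: Permutation_trans p.
  by apply: Permutation_map_att; apply: Permutation_sym.
- by rewrite -x ex -map_comp.
Qed.

Lemma Permutation_perm_eq (T : eqType) (s t : seq T) : Permutation s t -> perm_eq s t.
Proof.
elim=> [|x l l' _|x y l|l l' l'' _ h _] //=; first by rewrite perm_cons.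
  by rewrite (perm_catCA [:: y] [:: x] l).
exact: seq.perm_trans h.
Qed.

Lemma path_edges_nth L (w : seq L) d k : k < size w -> List.In (nth d w k, [:: k; k.+1]) (path_edges 0 w).
Proof.
move=> hk; have := path_edges_In 0 (take k w) (drop k.+1 w) (nth d w k).
by rewrite -drop_nth // cat_take_drop size_takel // ltnW.
Qed.

(** The position map is injective, and also onto: 0 comes from the first external node and [k.+1]
    from the target of the edge at [k]. This fixes the number of nodes and makes the map an
    isomorphism. *)
Lemma giso_strg L (G : graph L) w : is_string G w -> giso G (strg w).
Proof.
move=> [f [/nodes_okE[ok1 ok2] r i p x]].
have en : nv G = (size w).+1.
  rewrite -(size_iota 0 (nv G)) -(size_map f) -(size_iota 0 (size w).+1).
  apply: perm_size; apply: uniq_perm.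
  - rewrite map_inj_in_uniq ?iota_uniq // => y z.
    by rewrite !mem_iota => hy hz; apply: i.
  - exact: iota_uniq.
  move=> k; rewrite mem_iota ltnS /=; apply/idP/idP.
    by case/mapP => y; rewrite mem_iota => hy ->; apply: r.
  case: k => [_|k hk].
    have [s [t [e hs ht]]] := map2I x.
    by apply/mapP; exists s; rewrite ?hs // mem_iota; move: ok2; rewrite e => /andP[].
  have [d _] : exists d : L, True by case: (w) hk => [|d l] //; exists d.
  have := path_edges_nth d hk.
  move/(Permutation_in _ (Permutation_sym p))/List.in_map_iff => [e [[_ he] ein]].
  have : k.+1 \in map f e.2 by rewrite he !inE eqxx orbT.
  case/mapP => v ve ->; rewrite map_f // mem_iota.
  by move/all_In: ok1 => /(_ _ ein)/allP /(_ _ ve).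
split; first by rewrite en.
exists f; split; first by move=> y /r; rewrite en.
by split=> //; split; first exact: Permutation_sym.
Qed.

(** * Separating edge lists and tracking occupied positions *)

Lemma Permutation_filter T (a : pred T) s t :
  Permutation s t -> Permutation (filter a s) (filter a t).
Proof.
elim=> [|x l l' _ h|x y l|l l' l'' _ h1 _ h2] //=; first 1 last.
- by case: (a x); case: (a y) => //; apply: perm_swap.
- exact: Permutation_trans h1 h2.
by case: (a x) => //; apply: perm_skip.
Qed.

Lemma Permutation_separate T (a : pred T) s1 s2 t1 t2 :
  Permutation (s1 ++ s2) (t1 ++ t2) -> all a s1 -> all a t1 ->
  all (predC a) s2 -> all (predC a) t2 -> Permutation s1 t1 /\ Permutation s2 t2.
Proof.
move=> p as1 at1 as2 at2.
have h0 b (s : seq T) : all (predC b) s -> filter b s = [::].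
  by elim: s => //= x s IH /andP[/negbTE -> /IH].
have nn s : all a s -> all (predC (predC a)) s by apply: sub_all => x /= ->.
split.
  have := Permutation_filter a p; rewrite !filter_cat (h0 a s2) // (h0 a t2) // !cats0.
  by rewrite (all_filterP as1) (all_filterP at1).
have := Permutation_filter (predC a) p; rewrite !filter_cat (h0 (predC a) s1) ?nn // (h0 (predC a) t1) ?nn // !cat0s.
by rewrite (all_filterP as2) (all_filterP at2).
Qed.

(** With [F] the position map of a component having [n] nodes, these are the positions which that
    component occupies. *)
Definition hits n (F : nat -> nat) k := exists2 x, x < n & F x = k.

Lemma In_map_att L n F (es : seq (L * seq nat)) e k :
  att_below n es -> List.In e (map_att F es) -> k \in e.2 -> hits n F k.
Proof.
move=> /all_In ok /List.in_map_iff[e' [<- ie]] /mapP[v ve ->].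
by exists v => //; move: (ok _ ie) => /allP /(_ _ ve).
Qed.

(** Edges of a path have distinct sources, so the source serves as the position of an edge. *)
Definition source L (e : L * seq nat) := head 0 e.2.

Lemma heads_path_edges L s (w : seq L) : map (@source L) (path_edges s w) = iota s (size w).
Proof. by elim: w s => // x w IH s; rewrite path_edges_cons /= IH. Qed.

Lemma all_path_edges L (a : pred nat) s (w : seq L) :
  (forall k, s <= k < s + size w -> a k) -> all (fun e => a (source e)) (path_edges s w).
Proof.
move=> h; have : all a (map (@source L) (path_edges s w)).
  by rewrite heads_path_edges; apply/allP => k; rewrite mem_iota => /h.
by rewrite all_map.
Qed.

(** * Recovering the components of a string *)

(** Walking up from 0, one stays in [A] as long as [m] is not reached, since a step inside [B] would
    start at a common position. Walking down from [n], one stays in [B] for the same reason. *)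
Lemma two_paths n m (A B : nat -> Prop) : A 0 -> B n ->
  (forall k, A k -> B k -> k = m) ->
  (forall k, k < n -> A k /\ A k.+1 \/ B k /\ B k.+1) ->
  (forall k, k <= m -> k <= n -> A k) /\ (forall k, m <= k <= n -> B k).
Proof.
move=> A0 Bn AB E; split.
  elim=> [|k IH] // km kn; have Ak := IH (ltnW km) (ltnW kn).
  by case: (E k kn) => -[] // Bk; have := AB k Ak Bk; lia.
have H j : j <= n -> m <= n - j -> B (n - j).
  elim: j => [|j IH] hj hm; first by rewrite subn0.
  have := E (n - j.+1); have -> : (n - j.+1).+1 = n - j by lia.
  case=> [|[_ Aj]|[]] //; first by lia.
  by have := AB _ Aj (IH (ltnW hj) _); lia.
by move=> k hk; have := H (n - k); rewrite subKn; [apply; lia|lia].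
Qed.

(** The position map of the string is injective on each component, and the components share only the
    position [m] of node 1. By [two_paths] they fill the positions up to [m] and from [m] on, so [w]
    is cut at [m]. *)
Lemma is_string_timesV L (a b : L) H0 H1 w : nodes_ok H0 -> nodes_ok H1 ->
  size (ext H0) = 2 -> size (ext H1) = 2 ->
  is_string (subst (strg [:: a; b]) [:: (0, H0); (1, H1)]) w ->
  exists w0 w1, [/\ w = w0 ++ w1, is_string H0 w0 & is_string H1 w1].
Proof.
move=> ok0 ok1 sz0 sz1 [f]; move: (ok0) (ok1) => /nodes_okE[n0 x0] /nodes_okE[n1 x1].
case e0: (ext H0) sz0 x0 => [|s0 [|t0 []]] //= _ /and3P[ls0 lt0 _].
case e1: (ext H1) sz1 x1 => [|s1 [|t1 []]] //= _ /and3P[ls1 lt1 _].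
rewrite strg2_subst2E e0 e1 => /string_pos_glueV[]; first by rewrite /pairs_below /=; lia.
move=> g [hg rg kg pg xg].
have [q1 q2 q3 q4] : [/\ g (3 + s0) = g 0, g (3 + t0) = g 1,
      g (3 + nv H0 + s1) = g 1 & g (3 + nv H0 + t1) = g 2].
  by split; apply: (hg (_, _)); rewrite !inE eqxx ?orbT.
case: xg => g00 g2n.
pose F0 y := g (3 + y); pose F1 y := g (3 + nv H0 + y).
set m := g 1 in q2 q3.
(* Test maps: [t] keeps [H0] and contracts [H1] onto [t0]; [t'] keeps [H1] and contracts [H0] onto
   [s1]. *)
pose t z := if z < 3 then (if z == 0 then s0 else t0) else if z < 3 + nv H0 then z - 3 else t0.
pose t' z := if z < 3 then (if z == 2 then t1 else s1) else if z < 3 + nv H0 then s1 else z - (3 + nv H0).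
have K0 := kg t; have K1 := kg t'.
have {}K0 y z : y < 3 + (nv H0 + nv H1) -> z < 3 + (nv H0 + nv H1) -> g y = g z -> t y = t z.
  apply: K0 => p; rewrite !inE /t; case/or4P => /eqP -> /=; rewrite ?ltn_add2l ?ls0 ?lt0 ?addKn //.
    by rewrite ifF //; lia.
  by rewrite ifF //; lia.
have {}K1 y z : y < 3 + (nv H0 + nv H1) -> z < 3 + (nv H0 + nv H1) -> g y = g z -> t' y = t' z.
  apply: K1 => p; rewrite !inE /t'; case/or4P => /eqP -> /=; rewrite ?ltn_add2l ?ls0 ?lt0 ?addKn //.
    by rewrite ifF //; lia.
  by rewrite ifF //; lia.
have t0E y : y < nv H0 -> t (3 + y) = y by move=> hy; rewrite /t ltn_add2l hy addKn.
have t1E y : t (3 + nv H0 + y) = t0 by rewrite /t !ifF //; lia.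
have t1'E y : t' (3 + nv H0 + y) = y by rewrite /t' !ifF ?addKn //; lia.
have i0 x y : x < nv H0 -> y < nv H0 -> F0 x = F0 y -> x = y.
  by move=> hx hy /K0; rewrite !t0E //; apply; lia.
have i1 x y : x < nv H1 -> y < nv H1 -> F1 x = F1 y -> x = y.
  by move=> hx hy /K1; rewrite !t1'E //; apply; lia.
have X k : hits (nv H0) F0 k -> hits (nv H1) F1 k -> k = m.
  move=> [x hx <-] [y hy] e; have := K0 (3 + x) (3 + nv H0 + y).
  by rewrite t0E // t1E /F0 => -> //; lia.
have r0 y : y < nv H0 -> F0 y <= size w by move=> hy; apply: rg => /=; lia.
have r1 y : y < nv H1 -> F1 y <= size w by move=> hy; apply: rg => /=; lia.
move: pg; rewrite /= map_att_cat !map_att_comp -/F0 -/F1 => pg.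
have B0 : hits (nv H0) F0 0 by exists s0 => //; rewrite /F0 q1 g00.
have Bn : hits (nv H1) F1 (size w) by exists t1 => //; rewrite /F1 q4 g2n.
have [|A B] := two_paths B0 Bn X.
  move=> k hk; have [d _] : exists d : L, True by exists a.
  have := Permutation_in _ (Permutation_sym pg) (path_edges_nth d hk).
  case/In_cat => [/In_map_att h|/In_map_att h]; [left|right]; split;
    by apply: h; rewrite // !inE eqxx ?orbT.
have mw : m <= size w by apply: (rg 1) => /=; lia.
have v0 k : hits (nv H0) F0 k -> k <= m.
  move=> h; rewrite leqNgt; apply/negP => km; have kw : k <= size w by case: h => x /r0 + <-.
  have := X k h (B k _); lia.
have v1 k : hits (nv H1) F1 k -> m <= k.
  move=> h; rewrite leqNgt; apply/negP => km; have kw : k <= size w by case: h => x /r1 + <-.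
  have := X k (A k _ _) h; lia.
have [P0 P1] : Permutation (map_att F0 (edges H0)) (path_edges 0 (take m w)) /\
    Permutation (map_att F1 (edges H1)) (path_edges m (drop m w)).
  (* An edge of [H0] has its target at most at [m], hence its source below [m]; an edge of [H1] has
     its source at [m] or later. *)
  apply: (@Permutation_separate _ (fun e => source e < m)).
  - by move: (pg); rewrite -{1}(cat_take_drop m w) path_edges_cat size_takel.
  - apply/all_In => e ie.
    have /In_path_edges[w1 [x [w2 [_ ee]]]] := Permutation_in _ pg (proj2 (In_cat _ _ _) (or_introl ie)).
    rewrite /source ee /=; apply: (v0 (_.+1)); apply: In_map_att n0 ie _.
    by rewrite ee !inE eqxx orbT.
  - by apply: (@all_path_edges _ (fun k => k < m)) => k; rewrite size_takel.
  - apply/all_In => e ie.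
    have /In_path_edges[w1 [x [w2 [_ ee]]]] := Permutation_in _ pg (proj2 (In_cat _ _ _) (or_intror ie)).
    rewrite /source ee /= -leqNgt; apply: v1; apply: In_map_att n1 ie _.
    by rewrite ee !inE eqxx.
  - by apply: (@all_path_edges _ (fun k => ~~ (k < m))) => k; lia.
exists (take m w), (drop m w); split; first by rewrite cat_take_drop.
- exists F0; split=> //; first by move=> x hx; rewrite size_takel //; apply: v0; exists x.
  by rewrite e0 /= /F0 q1 q2 g00 size_takel.
exists (fun y => F1 y - m); split=> //; rewrite ?size_drop.
- by move=> x /r1; lia.
- move=> x y hx hy; have := v1 (F1 x); have := v1 (F1 y) => h1 h2 e.
  apply: i1 => //; have : m <= F1 x by apply: h2; exists x.
  have : m <= F1 y by [apply: h1; exists y]; lia.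
- have := Permutation_map_att (fun k => k - m) P1; rewrite map_att_comp (@map_att_path_edges _ m 0) // => y; lia.
- by rewrite e1 /= /F1 q3 q4 g2n subnn.
Qed.

Lemma rem_at_cat T (s t : seq T) i : rem_at (size s + i) (s ++ t) = s ++ rem_at i t.
Proof.
rewrite /rem_at take_cat drop_cat ltnNge leq_addr -addnS ltnNge leq_addr /= !addKn.
by rewrite catA.
Qed.

(** The case of [\]: [A] and [B] are the positions of [H] and [H1], and the edge at [p] leads from
    [B] to [A]. Going down from [p] one stays in [B] until [u]; going up from 0 to [u], and from
    [p.+1] to [n], one stays in [A], because any other switch would need a second common
    position. *)
Lemma div_interval n p u (A B : nat -> Prop) : A 0 -> A n -> A p.+1 -> B p ->
  A u -> B u -> p < n -> u <= n ->
  (forall k, A k -> B k -> k = u) ->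
  (forall k, k < n -> k != p -> A k /\ A k.+1 \/ B k /\ B k.+1) ->
  u <= p /\ forall k, k <= n -> (A k <-> k <= u \/ p < k) /\ (B k <-> u <= k <= p).
Proof.
move=> A0 An Ap Bp Au Bu pn un AB E.
have H k : k <= p -> B k -> u <= k /\ forall j, u <= j <= k -> B j.
  elim: k => [|k IH] kp Bk.
    by have <- := AB 0 A0 Bk; split=> // j; rewrite leqn0 => /andP[_ /eqP ->].
  case: (eqVneq k.+1 u) => [<-|ne].
    by split=> // j hj; have -> : j = k.+1 by lia.
  have [||[_ Ak]|[Bk' _]] := E k; try lia; first by have := AB _ Ak Bk; lia.
  have [|uk h] := IH _ Bk'; first lia.
  split; first lia.
  move=> j hj; case: (eqVneq j k.+1) => [-> //|nj]; apply: h; lia.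
have [up hB] := H p (leqnn _) Bp.
have hA k : k <= u -> A k.
  elim: k => [|k IH] // ku; have Ak := IH (ltnW ku).
  have [||[]|[Bk _]] // := E k; try lia; have := AB _ Ak Bk; lia.
have hA' d : p.+1 + d <= n -> A (p.+1 + d).
  elim: d => [|d IH]; rewrite ?addn0 // addnS => hd; have Ak := IH (ltnW hd).
  have [||[]|[Bk _]] // := E (p.+1 + d); try lia; have := AB _ Ak Bk; lia.
split=> // k kn; split; split.
- move=> Ak; case: (leqP k u) => ku; first by left.
  right; rewrite ltnNge; apply/negP => kp; have := AB k Ak (hB k _); lia.
- case=> [/hA //|pk]; have := hA' (k - p.+1); rewrite subnKC //; exact.
- move=> Bk; case: (leqP u k) => ku /=; last by have := AB k (hA k (ltnW ku)) Bk; lia.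
  rewrite leqNgt; apply/negP => pk.
  have Ak : A k by have := hA' (k - p.+1); rewrite subnKC //; exact.
  by have := AB k Ak Bk; lia.
- exact: hB.
Qed.

(** The case of [/], obtained from [div_interval] by reversing the string. *)
Lemma div_interval_r n p u (A B : nat -> Prop) : A 0 -> A n -> A p -> B p.+1 ->
  A u -> B u -> p < n -> u <= n ->
  (forall k, A k -> B k -> k = u) ->
  (forall k, k < n -> k != p -> A k /\ A k.+1 \/ B k /\ B k.+1) ->
  p < u /\ forall k, k <= n -> (A k <-> k <= p \/ u <= k) /\ (B k <-> p < k <= u).
Proof.
move=> A0 An Ap Bp Au Bu pn un AB E.
have R k : k <= n -> n - (n - k) = k by lia.
have S k : k < n -> (n - k.+1).+1 = n - k by lia.
(* The conjunct [k <= n] excludes the positions beyond [n], all of which truncated subtraction would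
   send to 0. *)
have [||||||||||up H] := @div_interval n (n - p.+1) (n - u)
  (fun k => k <= n /\ A (n - k)) (fun k => k <= n /\ B (n - k)).
- by rewrite subn0.
- by rewrite subnn.
- by rewrite S // R; [split=> //; lia|lia].
- by rewrite R //; split=> //; lia.
- by rewrite R //; split=> //; lia.
- by rewrite R //; split=> //; lia.
- lia.
- lia.
- by move=> k [kn Ak] [_ Bk]; have := AB _ Ak Bk; lia.
- move=> k kn kp; have := E (n - k.+1); rewrite S // => -[]; try lia.
    by move=> [a1 a2]; left; do !split=> //; lia.
  by move=> [a1 a2]; right; do !split=> //; lia.
split; first lia.
move=> k kn; have [|h1 h2] := H (n - k); first lia.
rewrite R // in h1 h2; split; split.
- by move=> Ak; have [|] := proj1 h1 (conj (leq_subr _ _) Ak); lia.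
- by move=> hk; apply: (proj2 (proj2 h1 _)); lia.
- by move=> Bk; have := proj1 h2 (conj (leq_subr _ _) Bk); lia.
- by move=> hk; apply: (proj2 (proj2 h2 _)); lia.
Qed.

Lemma eatt_cat L n (es es' : seq (L * seq nat)) x i :
  eatt (Graph n (es ++ es') x) (size es + i) = eatt (Graph n es' x) i.
Proof. by rewrite /eatt /= map_cat nth_cat size_map ltnNge leq_addr addKn. Qed.

(* The two implications are treated at once: [r] tells whether the edge [t]
   precedes [b] in the denominator ([/]) or follows it ([\]). *)
Lemma is_string_divV L (r : bool) (H H1 : graph L) e (b t : L) w d :
  nodes_ok H -> nodes_ok H1 -> e < size (edges H) ->
  size (eatt H e) = 2 -> size (ext H1) = 2 -> size (ext H) = 2 ->
  is_string (subst (subst H [:: (e, strg (if r then [:: t; b] else [:: b; t]))])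
                [:: ((size (edges H)).-1 + r, H1)]) w ->
  exists w1 w2 w3, [/\ w = w1 ++ (if r then t :: w2 else rcons w2 t) ++ w3,
    is_string H (w1 ++ (nth d (edges H) e).1 :: w3) & is_string H1 w2].
Proof.
move=> okH okH1 he sza szx1 szx [f]; move: (okH) (okH1) => /nodes_okE[nH xH] /nodes_okE[nH1 xH1].
have := eatt_lt nH he.
case ea: (eatt H e) sza => [|a [|c []]] //= _ /and3P[la lc _].
case e1: (ext H1) szx1 xH1 => [|s [|z []]] //= _ /and3P[ls lz _].
case eX: (ext H) szx xH => [|y0 [|y1 []]] //= _ /and3P[ly0 ly1 _].
set l0 := if r then t else b; set l1 := if r then b else t.
have -> : strg (if r then [:: t; b] else [:: b; t]) =
    Graph 3 [:: (l0, [:: 0; 1]); (l1, [:: 1; 2])] [:: 0; 2] by rewrite /l0 /l1; case: (r).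
have [kept Ekept] : exists s, s = rem_at e (edges H) by exists (rem_at e (edges H)).
have nk : att_below (nv H) kept by rewrite Ekept; apply: att_below_rem_at.
rewrite [subst H _]subst1E ea /= -Ekept.
set P1 := Graph _ _ _; set ps1 := [:: _; _].
have [|q [n [-> [qp qf] qb qs]]] := @glue_spec _ P1 ps1; first by rewrite /pairs_below /=; lia.
rewrite /map_nodes /= map_cat /= -[[seq _ | _ <- kept]]/(map_att q kept).
have -> : (size (edges H)).-1 = size (map_att q kept) by rewrite size_map Ekept size_rem_at.
rewrite subst1E /= eatt_cat rem_at_cat e1.
(* The inserted string has nodes [nv H], [nv H + 1] and [nv H + 2]. The edge [b] has index [r] in it
   and starts at [j]; the edge [t] has index [~~ r] and starts at [i]. *)
pose j := nv H + r; rewrite (_ : eatt _ r = [:: q j; q j.+1]); last first.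
  by rewrite /j; case: (r); rewrite /eatt /= ?addn0 ?addn1 ?addn2.
pose i := nv H + ~~ r; rewrite (_ : rem_at r _ = [:: (t, [:: q i; q i.+1])]); last first.
  by rewrite /i /rem_at /l0 /l1; case: (r); rewrite /= ?addn0 ?addn1 ?addn2.
have [qj qj1] : q j < n /\ q j.+1 < n by split; apply: qb; rewrite /= /j; case: (r); lia.
case/string_pos_glueV => /=; first by rewrite /pairs_below /=; lia.
move=> g [hg rg kg pg xg].
have [gs gz] : g (n + s) = g (q j) /\ g (n + z) = g (q j.+1).
  by split; apply: (hg (_, _)); rewrite !inE eqxx ?orbT.
have [qa qc] : q (nv H) = q a /\ q (nv H + 2) = q c.
  by rewrite -{1}[nv H]addn0; split; apply: (qp (_, _)); rewrite !inE eqxx ?orbT.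
pose F x := g (q x); pose F1 x := g (n + x).
(* The end [so] of [H1] is glued to the node [o] of [H], and the other end [si] to the inner node of
   the inserted string. *)
pose o := if r then c else a; pose so := if r then z else s; pose si := if r then s else z.
have lt_o : o < nv H by rewrite /o; case: (r).
have lso : so < nv H1 by rewrite /so; case: (r).
have Fo : F1 so = F o.
  rewrite /F /F1 /o /so /j in gs gz *; case: (r) gs gz => /= gs gz.
    by rewrite gz -qc addn1 addn2.
  by rewrite gs -qa addn0.
(* Contracting the edges replacing [e] onto the node [o] shared by [H] and [H1]
   shows that no two nodes of [H] were merged. *)
have [h1 hh1] : exists h1, forall x, (if x < nv H then x else
    if x == nv H then a else if x == (nv H).+1 then o else c) = h1 (q x).
  apply: qf => p; rewrite !inE => /orP[] /eqP -> /=; rewrite ?addn0 ?ltnn ?eqxx ?la //.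
  by rewrite lc !ifF; lia.
(* For the nodes of [H1], all of [H] is contracted onto [so]. *)
have [h2 hh2] : exists h2, forall x, (if x == (nv H).+1 then si else so) = h2 (q x).
  by apply: qf => p; rewrite !inE => /orP[] /eqP -> /=; rewrite !ifF; lia.
have T1 := kg (fun x => if x < n then h1 x else o).
have {}T1 x y : x < n + nv H1 -> y < n + nv H1 -> g x = g y ->
    (if x < n then h1 x else o) = (if y < n then h1 y else o).
  apply: T1 => p; rewrite !inE; case/orP => /eqP -> /=;
    rewrite ltnNge leq_addr /= ifT ?qb /= -?hh1 /j /o; try lia.
    by case: (r); rewrite ?addn0 ?addn1 ?ltnn ?eqxx ?ifF; lia.
  by case: (r); rewrite ?addn0 ?addn1 ?ltnn ?eqxx ?ifF; lia.
have T2 := kg (fun x => if x < n then h2 x else x - n).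
have {}T2 x y : x < n + nv H1 -> y < n + nv H1 -> g x = g y ->
    (if x < n then h2 x else x - n) = (if y < n then h2 y else y - n).
  apply: T2 => p; rewrite !inE; case/orP => /eqP -> /=;
    rewrite ltnNge leq_addr /= ifT ?qb /= -?hh2 /j /so /si ?addKn; try lia.
    by case: (r); rewrite ?addn0 ?addn1 ?eqxx // ifF; lia.
  by case: (r); rewrite ?addn0 ?addn1 ?eqxx // ifF; lia.
have qH x : x < nv H -> q x < n by move=> hx; apply: qb; rewrite /=; lia.
have iF x y : x < nv H -> y < nv H -> F x = F y -> x = y.
  move=> hx hy /T1; rewrite !qH // -!hh1 hx hy; apply; have := qH _ hx; have := qH _ hy; lia.
have iF1 x y : x < nv H1 -> y < nv H1 -> F1 x = F1 y -> x = y.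
  move=> hx hy /T2; rewrite !ifF ?addKn; try lia; apply; lia.
have AB k : hits (nv H) F k -> hits (nv H1) F1 k -> k = F o.
  move=> [x hx <-] [y hy] /esym/T1; rewrite qH // -hh1 hx ifF; last lia.
  by move=> -> //; have := qH _ hx; lia.
have rF x : x < nv H -> F x <= size w by move=> /qH hx; apply: rg; lia.
have rF1 x : x < nv H1 -> F1 x <= size w by move=> hx; apply: rg; lia.
move: pg xg; rewrite !map_att_cat !map_att_comp /= -/F1 eX /= => pg [F0 Fn].
have eF : map_att (g \o q) kept = map_att F kept by [].
have eF1 : map_att (g \o addn n) (edges H1) = map_att F1 (edges H1) by [].
rewrite eF eF1 -catA /= in pg.
have : List.In (t, [:: g (q i); g (q i.+1)]) (path_edges 0 w).
  by apply: Permutation_in pg _; apply/In_cat; right; left.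
case/In_path_edges => wa [t' [wb [ew [et p1 p2]]]].
rewrite add0n in p1 p2; subst t'.
set p := size wa in p1 p2.
have pw : p < size w by rewrite ew size_cat /= -/p; lia.
rewrite p1 p2 in pg.
(* Sources are distinct, so [t] is the only edge at position [p]. *)
have up : uniq (map (@source L) (map_att F kept ++ (t, [:: p; p.+1]) :: map_att F1 (edges H1))).
  rewrite (perm_uniq (_ : perm_eq _ (map (@source L) (path_edges 0 w)))); first by rewrite heads_path_edges iota_uniq.
  by apply: Permutation_perm_eq; apply: Permutation_map.
set u := F o in AB Fo.
(* The ends of [e] lie at [lo] and [hi], and [H1] will fill the interval from [l] to [h]. The edge
   [t] leads from [lo] to [l] for [/] and from [h] to [hi] for [\]. *)
pose lo := if r then p else u; pose hi := if r then u else p.+1.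
pose l := if r then p.+1 else u; pose h := if r then u else p.
have uw : u <= size w by apply: rF.
have [Fa Fc F1s F1z] : [/\ F a = lo, F c = hi, F1 s = l & F1 z = h].
  rewrite /lo /hi /l /h -p2 -p1 /u /F /F1 gs gz /o /i /j.
  case: (r) => /=.
    have -> : (nv H + 1).+1 = nv H + 2 by lia.
    have -> : (nv H + 0).+1 = nv H + 1 by lia.
    by rewrite addn0 -qc qa.
  have -> : (nv H + 1).+1 = nv H + 2 by lia.
  have -> : (nv H + 0).+1 = nv H + 1 by lia.
  by rewrite addn0 qa qc.
have ed k : k < size w -> k != p -> hits (nv H) F k /\ hits (nv H) F k.+1 \/
    hits (nv H1) F1 k /\ hits (nv H1) F1 k.+1.
  move=> hk kp; have := Permutation_in _ (Permutation_sym pg) (path_edges_nth t hk).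
  case/In_cat => [/In_map_att h'|[[_ ek]|/In_map_att h']].
  - by left; split; apply: h'; rewrite // !inE eqxx ?orbT.
  - by rewrite ek eqxx in kp.
  - by right; split; apply: h'; rewrite // !inE eqxx ?orbT.
have [lh Q] : [/\ lo < hi, l <= h, lo <= l & h <= hi] /\ forall k, k <= size w ->
    (hits (nv H) F k <-> k <= lo \/ hi <= k) /\ (hits (nv H1) F1 k <-> l <= k <= h).
  have A0 : hits (nv H) F 0 by exists y0.
  have An : hits (nv H) F (size w) by exists y1.
  have Aa : hits (nv H) F lo by exists a.
  have Ac : hits (nv H) F hi by exists c.
  have Bs : hits (nv H1) F1 l by exists s.
  have Bz : hits (nv H1) F1 h by exists z.
  rewrite /lo /hi /l /h in Aa Ac Bs Bz *; case: (r) Aa Ac Bs Bz => Aa Ac Bs Bz.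
    have [pu Q] := div_interval_r A0 An Aa Bs Ac Bz pw uw AB ed.
    by split=> //; split; lia.
  have [pu Q] := div_interval A0 An Ac Bz Aa Bs pw uw AB ed.
  by split=> //; split; lia.
have [lohi lh' lol hhi] := lh.
(* The words [wa] and [wb] stand before and after [t]; one of them is cut at the common position
   [u]. *)
have [w1 [w2 [w3 [ew' [s1 s2 s3] path_edges']]]] : exists w1 w2 w3,
   [/\ w = w1 ++ (if r then t :: w2 else rcons w2 t) ++ w3,
       [/\ size w1 = lo, size w2 = h - l & size w3 = size w - hi] &
       Permutation (path_edges 0 w) ((path_edges 0 w1 ++ path_edges hi w3) ++ (t, [:: p; p.+1]) :: path_edges l w2)].
  have sw : size w = p + (size wb).+1 by rewrite ew size_cat.
  rewrite /lo /hi /l /h in lohi lh' lol hhi *; case: (r) lohi lh' lol hhi => lohi lh' lol hhi.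
    exists wa, (take (u - p.+1) wb), (drop (u - p.+1) wb); split.
    - by rewrite /= cat_take_drop.
    - by rewrite size_takel ?size_drop; [split|]; lia.
    rewrite {1}ew path_edges_cat path_edges_cons -/p -{1}(cat_take_drop (u - p.+1) wb) path_edges_cat.
    rewrite size_takel; last lia.
    rewrite add0n -/p subnKC // -catA; apply: Permutation_cat => //.
    exact: (Permutation_catC (_ :: _)).
  exists (take u wa), (drop u wa), wb; split.
  - by rewrite cat_rcons catA cat_take_drop.
  - by rewrite size_takel ?size_drop //; split; lia.
  rewrite {1}ew path_edges_cat path_edges_cons -{1}(cat_take_drop u wa) path_edges_cat add0n -/p.
  rewrite size_takel // add0n -!catA; apply: Permutation_cat => //.
  rewrite -[_ :: path_edges p.+1 wb]cat1s catA; apply: Permutation_trans (Permutation_catC _ _) _.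
  apply: Permutation_cat => //; exact: (Permutation_catC _ [:: _]).
have pg' := Permutation_app_inv _ _ _ _ _ (Permutation_trans pg path_edges').
have kin ee : List.In ee (map_att F kept) -> source ee < lo \/ hi <= source ee.
  move=> ie; have := Permutation_in _ pg (proj2 (In_cat _ _ _) (or_introl ie)).
  case/In_path_edges => v1 [x [v2 [ev eE]]]; rewrite add0n in eE.
  have kw : size v1 < size w by rewrite ev size_cat /=; lia.
  have [k1 k2] : hits (nv H) F (size v1) /\ hits (nv H) F (size v1).+1.
    by split; apply: In_map_att nk ie _; rewrite eE !inE eqxx ?orbT.
  (* An edge of [H] could pass from [lo] to [hi] only if [hi = lo.+1]; it would then lie at [p], the
     place of [t]. *)
  have kp : size v1 != p.
    apply/negP => /eqP ep; move: up; rewrite map_cat cat_uniq /= /source /= => /and3P[_ /norP[/negP hp _] _].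
    apply: hp; apply/In_mem; apply/List.in_map_iff; exists ee; split=> //.
    by rewrite eE.
  have := proj1 (proj1 (Q _ (ltnW kw)) ) k1; have := proj1 (proj1 (Q _ kw)) k2.
  rewrite eE /source /=; rewrite /lo /hi in lohi *; move: kp lohi; case: (r); lia.
have ein ee : List.In ee (map_att F1 (edges H1)) -> l <= source ee < h.
  move=> ie; have := Permutation_in _ pg (proj2 (In_cat _ _ _) (or_intror (List.in_cons _ _ _ ie))).
  case/In_path_edges => v1 [x [v2 [ev eE]]]; rewrite add0n in eE.
  have kw : size v1 < size w by rewrite ev size_cat /=; lia.
  have [k1 k2] : hits (nv H1) F1 (size v1) /\ hits (nv H1) F1 (size v1).+1.
    by split; apply: In_map_att nH1 ie _; rewrite eE !inE eqxx ?orbT.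
  have := proj1 (proj2 (Q _ (ltnW kw)) ) k1; have := proj1 (proj2 (Q _ kw)) k2.
  by rewrite eE /source /=; lia.
have [Pk P1'] : Permutation (map_att F kept) (path_edges 0 w1 ++ path_edges hi w3) /\
    Permutation (map_att F1 (edges H1)) (path_edges l w2).
  apply: (@Permutation_separate _ (fun x => (source x < lo) || (hi <= source x))) => //.
  - by apply/all_In => x /kin[] ->; rewrite ?orbT.
  - rewrite all_cat; apply/andP; split.
      by apply: (@all_path_edges _ (fun k => (k < lo) || (hi <= k))) => k; rewrite s1; lia.
    by apply: (@all_path_edges _ (fun k => (k < lo) || (hi <= k))) => k; rewrite s3; lia.
  - by apply/all_In => x /ein /=; lia.
  - by apply: (@all_path_edges _ (fun k => ~~ ((k < lo) || (hi <= k)))) => k; rewrite s2; lia.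
have hiw : hi <= size w by rewrite /hi; case: (r).
exists w1, w2, w3; split=> //.
  (* The gap left by [H1] and [t] is contracted to one step from [lo] to [lo.+1], which [e]
     takes. *)
  pose G x := if x <= lo then x else x - hi + lo.+1.
  have vF x : x < nv H -> F x <= lo \/ hi <= F x.
    by move=> hx; apply: (proj1 (proj1 (Q _ (rF _ hx)))); exists x.
  have sw' : size (w1 ++ (nth d (edges H) e).1 :: w3) = lo + (size w - hi).+1.
    by rewrite size_cat /= s1 s3.
  exists (fun x => G (F x)); split=> //; rewrite ?sw'.
  - by rewrite /G => x hx; have := vF x hx; have := rF x hx; case: ifP; lia.
  - move=> x y hx hy E; apply: iF => //; have := vF x hx; have := vF y hy.
    by move: E; rewrite /G; do 2!case: ifP; lia.
  - rewrite {1}(rem_at_split d he) map_att_cat /= -eattE // ea /= Fa Fc.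
    have [-> ->] : G lo = lo /\ G hi = lo.+1 by rewrite /G leqnn; case: ifP; lia.
    apply: Permutation_trans (Permutation_sym (Permutation_middle _ _ _)) _.
    rewrite path_edges_cat path_edges_cons s1 add0n.
    apply: Permutation_trans (Permutation_middle _ _ _); apply: perm_skip.
    have := Permutation_map_att G Pk; rewrite map_att_comp Ekept /rem_at !map_att_cat.
    rewrite (@map_att_path_edges _ 0 0) => [|x hx]; last by rewrite /G; case: ifP; lia.
    by rewrite (@map_att_path_edges _ hi lo.+1) // => x hx; rewrite /G; case: ifP; lia.
  - by rewrite eX /= /G /F F0 Fn /=; congr [:: _; _]; case: ifP; lia.
exists (fun x => F1 x - l); split=> //; rewrite ?s2.
- by move=> x hx; have := proj1 (proj2 (Q _ (rF1 x hx))); move=> /(_ (ex_intro2 _ _ x hx erefl)); lia.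
- move=> x y hx hy E; apply: iF1 => //.
  have ix : l <= F1 x <= h by apply: (proj1 (proj2 (Q _ (rF1 x hx)))); exists x.
  have iy : l <= F1 y <= h by apply: (proj1 (proj2 (Q _ (rF1 y hy)))); exists y.
  lia.
- have := Permutation_map_att (fun k => k - l) P1'; rewrite map_att_comp (@map_att_path_edges _ l 0) // => x; lia.
- by rewrite e1 /= F1s F1z subnn.
Qed.

(** * The translation *)

Lemma wf_strg_ty (w : seq ty) :
  (forall t, List.In t w -> wf_ty t /\ arity t = 2) -> forall G, is_string G w -> wf_graph G.
Proof.
move=> hw G [f [ok _ _ pm _]]; split=> // e ie.
have := Permutation_in _ pm (List.in_map _ _ _ ie).
case/In_path_edges => w1 [t [w2 [ew [-> /(congr1 size)]]]].
rewrite size_map => ->; apply: hw; rewrite ew; apply/In_cat; right; by left.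
Qed.

Lemma arity_tr1 A : arity (tr1 A) = 2.
Proof. by case: A. Qed.

Lemma wf_tr1 A : wf_ty (tr1 A).
Proof.
have ok L (w : seq L) : nodes_ok (strg w) by case: (string_pos_strg w).
elim: A => [p||A IA B IB|A IA B IB|A IA B IB] //=.
- by split=> //; split=> //= v [<-|[<-|]].
- by rewrite !arity_tr1; do !split=> //; apply: (ok _ [:: Some (tr1 A); None]).
- by rewrite !arity_tr1; do !split=> //; apply: (ok _ [:: None; Some (tr1 B)]).
- by rewrite !arity_tr1; do !split=> //; apply: (ok _ [:: tr1 A; tr1 B]).
Qed.

Lemma wf_sequent_tr1 G Gamma C : is_string G (map tr1 Gamma) -> wf_sequent G (tr1 C).
Proof.
move=> sG; split; last first.
  split; first exact: wf_tr1.
  by case: sG => f [_ _ _ _ /(congr1 size)]; rewrite size_map arity_tr1.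
apply: wf_strg_ty sG => t /List.in_map_iff[A [<- _]].
by split; [apply: wf_tr1|apply: arity_tr1].
Qed.

(** All rules but the axiom and isomorphism carry this condition on their conclusion, so only these
    two cases remain. *)
Lemma hl_wf H A : hl_der H A -> wf_sequent H A.
Proof.
elim=> // {H A} [p n|G G' A _ [[ok lb] [wA sA]] [en [f [rf [_ [pm ex]]]]]].
  have ok : all (fun v => v < n) (iota 0 n) by apply/allP => v; rewrite mem_iota.
  split; last by rewrite /= size_iota.
  by split; [apply/nodes_okE; rewrite /= ok|move=> e [<-|//]; rewrite /= size_iota].
have /nodes_okE[ok1 ok2] := ok.
split; last by rewrite ex size_map.
split.
  apply/nodes_okE; rewrite -en ex; split.
    apply/all_In => e /(Permutation_in _ pm) /List.in_map_iff[e' [<- ie]] /=.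
    by rewrite all_map; move/all_In: ok1 => /(_ _ ie); apply: sub_all => v /rf.
  by rewrite all_map; apply: sub_all ok2 => v /rf.
move=> e /(Permutation_in _ pm) /List.in_map_iff[e' [<- ie]] /=.
by rewrite size_map; apply: lb.
Qed.

Lemma hl_strg G w A : hl_der G A -> is_string G w -> hl_der (strg w) A.
Proof. by move=> dG /giso_strg; apply: HL_iso dG. Qed.

Lemma size_edges_strg L (w : seq L) : size (edges (strg w)) = size w.
Proof. exact: size_path_edges. Qed.

Lemma nth_strg L (w1 w2 : seq L) x d :
  nth d (edges (strg (w1 ++ x :: w2))) (size w1) = (x, [:: size w1; (size w1).+1]).
Proof.
rewrite /= -/(path_edges 0 _) path_edges_cat path_edges_cons nth_cat.
by rewrite size_path_edges ltnn subnn.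
Qed.

Lemma is_string_subst_strg L (w1 w2 u : seq L) x H : is_string H u ->
  is_string (subst (strg (w1 ++ x :: w2)) [:: (size w1, H)]) (w1 ++ u ++ w2).
Proof.
move=> [h sH]; have hi : size w1 < size (edges (strg (w1 ++ x :: w2))).
  by rewrite size_edges_strg size_cat /=; lia.
have [|f [sf _]] := string_pos_subst1 (string_pos_strg _) hi _ sH; last by exists f.
by rewrite map_id (eattE (x, [::]) hi) nth_strg.
Qed.

(** Two replacements in a row, as in (÷ →): the edge of [x] by the denominator string, then the edge
    [b], whose position [size w1 + r] comes from the second conclusion of [string_pos_subst1]. *)
Lemma is_string_div L (r : bool) (w1 w2 u : seq L) x b t H : is_string H u ->
  is_string (subst (subst (strg (w1 ++ x :: w2))
            [:: (size w1, strg (if r then [:: t; b] else [:: b; t]))])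
          [:: ((size (edges (strg (w1 ++ x :: w2)))).-1 + r, H)])
    (w1 ++ (if r then t :: u else rcons u t) ++ w2).
Proof.
move=> [h sH]; set G := strg (w1 ++ _).
have hi : size w1 < size (edges G) by rewrite size_edges_strg size_cat /=; lia.
have [|f [sf ef]] := string_pos_subst1 (string_pos_strg _) hi _
  (string_pos_strg (if r then [:: t; b] else [:: b; t])).
  by rewrite map_id (eattE (x, [::]) hi) nth_strg.
set K := subst G _ in sf ef *.
have hK : (size (edges G)).-1 + r < size (edges K).
  by rewrite (string_pos_size sf) size_edges_strg !size_cat /=; case: (r) => /=; lia.
have e1 : map f (eatt K ((size (edges G)).-1 + r)) = [:: size w1 + r; (size w1 + r).+1].
  rewrite ef; first by case: (r); rewrite /eatt /= ?addn0 ?addn1 ?addn2.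
  by case: (r).
have [] := (hK, e1); move: sf; case: (r) => sf {}hK {}e1.
  have [||f' [sf' _]] := @string_pos_subst1 _ K H (w1 ++ [:: t]) b w2 u f h _ _ hK _ sH.
  - by rewrite -catA.
  - by rewrite e1 size_cat.
  by exists f'; rewrite -catA in sf'.
rewrite /= !addn0 in hK e1 *.
have [f' [sf' _]] := @string_pos_subst1 _ K H w1 b (t :: w2) u f h _ sf hK e1 sH.
by exists f'; rewrite cat_rcons.
Qed.

(** An injection of a finite set into itself is onto; its inverse is [index] in the list of its
    values. *)
Lemma giso_sym L (G G' : graph L) : nodes_ok G -> giso G G' -> giso G' G.
Proof.
move=> /nodes_okE[ok1 ok2] [en [f [rf [jf [pm ex]]]]].
pose s := map f (iota 0 (nv G)); pose g x := index x s.
have us : uniq s.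
  rewrite map_inj_in_uniq ?iota_uniq // => x y; rewrite !mem_iota; exact: jf.
have [_ ms] := uniq_min_size us (s2 := iota 0 (nv G)) ltac:(
  by move=> _ /mapP[x + ->]; rewrite !mem_iota; apply: rf) ltac:(by rewrite size_map).
have gf x : x < nv G -> g (f x) = x.
  move=> hx; rewrite /g -[X in f X](nth_iota x 0 hx) -(nth_map _ 0) ?size_iota //.
  by rewrite index_uniq // size_map size_iota.
have rg x : x < nv G -> g x < nv G.
  by move=> hx; rewrite /g -[X in _ < X](size_iota 0) -(size_map f) index_mem ms mem_iota.
have fg x : x < nv G -> f (g x) = x.
  move=> hx; have := @nth_index _ 0 x s; rewrite ms mem_iota => /(_ hx).
  by rewrite (nth_map 0) ?size_iota ?rg // nth_iota ?rg.
split; first by rewrite en.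
exists g; rewrite -en; split=> //; split=> [x y hx hy e|]; first by rewrite -(fg x) // e fg.
split; last by rewrite ex -map_comp -[LHS]map_id; apply: eq_map_lt ok2 _ => x /gf.
apply: Permutation_sym; apply: Permutation_trans (Permutation_map_att g pm) _.
rewrite -/(map_att f _) map_att_comp (eq_map_att (g := id) ok1) => [|x /gf //].
by rewrite -[X in Permutation _ X](congr1 (@edges L) (map_nodes_id G)).
Qed.

Lemma hl_str G w A : hl_der (strg w) A -> is_string G w -> hl_der G A.
Proof.
move=> dG sG; apply: HL_iso dG _; apply: giso_sym (giso_strg sG).
by case: sG => f [].
Qed.

(** * Simulating the Lambek rules *)

Lemma lder_hl Gamma C : lder Gamma C -> hl_der (strg (map tr1 Gamma)) (tr1 C).
Proof.
have st Ga : is_string (strg (map tr1 Ga)) (map tr1 Ga) by exists id; apply: string_pos_strg.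
elim=> {Gamma C}.
- by move=> p; apply: HL_ax.
(* The unit graph has no edges, so the family of replacing graphs is arbitrary. *)
- apply: (@HL_timesR (unit_graph ty) (fun=> unit_graph ty)) => //.
  exact: (@wf_sequent_tr1 _ [::] LOne (st [::])).
- move=> Pi Gm Dl A B C _ dA _ dC; rewrite !map_cat /= in dC *.
  have sH := is_string_div false (map tr1 Gm) (map tr1 Dl) (tr1 B) (tr1 A) (tr1 (LLeft A B)) (st Pi).
  rewrite /= cat_rcons in sH.
  apply: (hl_strg _ sH).
  apply: (HL_divL (D := strg [:: Some (tr1 A); None]) (N := tr1 B)
           (Hs := fun=> strg (map tr1 Pi)) dC).
  + by rewrite size_edges_strg size_cat /=; lia.
  + by rewrite /elab nth_strg.
  + exact: (wf_tr1 (LLeft A B)).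
  + by move=> [|[|j]] t // _ [<-].
  by apply: (@wf_sequent_tr1 _ (Gm ++ Pi ++ LLeft A B :: Dl)); rewrite !map_cat.
- move=> Pi A B _ dB; apply: HL_divR; last exact: (wf_sequent_tr1 (LLeft A B) (st Pi)).
  (* The [$] edge carries the label [tr1 B] until the string of [Pi] replaces it. *)
  have := is_string_subst_strg [:: tr1 A] [::] (tr1 B) (st Pi).
  rewrite cats0; exact: hl_str.
- move=> Gm Dl A B C _; rewrite !map_cat /= => dC.
  apply: (HL_timesL (F := strg [:: tr1 A; tr1 B]) (e := size (map tr1 Gm))).
  + by rewrite size_edges_strg size_cat /=; lia.
  + by rewrite /elab nth_strg.
  + apply: hl_str dC _.
    exact: (is_string_subst_strg _ _ _ (ex_intro _ id (string_pos_strg [:: tr1 A; tr1 B]))).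
  by have := @wf_sequent_tr1 _ (Gm ++ LProd A B :: Dl) C (st _); rewrite map_cat.
- move=> Pi Gm Dl A B C _ dA _ dC; rewrite !map_cat /= map_cat in dC *.
  have sH := is_string_div true (map tr1 Gm) (map tr1 Dl) (tr1 B) (tr1 A) (tr1 (LRight B A)) (st Pi).
  apply: (hl_strg _ sH).
  apply: (HL_divL (D := strg [:: None; Some (tr1 A)]) (N := tr1 B)
           (Hs := fun=> strg (map tr1 Pi)) dC).
  + by rewrite size_edges_strg size_cat /=; lia.
  + by rewrite /elab nth_strg.
  + exact: (wf_tr1 (LRight B A)).
  + by move=> [|[|j]] t // _ [<-].
  by apply: (@wf_sequent_tr1 _ (Gm ++ LRight B A :: Pi ++ Dl)); rewrite !map_cat /= map_cat.
- move=> Pi A B _ dB; apply: HL_divR; last exact: (wf_sequent_tr1 (LRight B A) (st Pi)).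
  apply: hl_str dB _; rewrite map_rcons -cats1.
  exact: (is_string_subst_strg [::] [:: tr1 A] (tr1 B) (st Pi)).
- move=> Pi Psi A B _ dA _ dB.
  have sG := is_string_times (tr1 A) (tr1 B) (st Pi) (st Psi).
  rewrite map_cat; apply: (hl_strg _ sG).
  apply: (HL_timesR (M := strg [:: tr1 A; tr1 B])
    (Hs := fun i => if i == 0 then strg (map tr1 Pi) else strg (map tr1 Psi))).
    by move=> [|[|i]].
  by apply: (@wf_sequent_tr1 _ (Pi ++ Psi) (LProd A B)); rewrite map_cat.
- move=> Gm Dl A _; rewrite !map_cat /= => dC.
  apply: (HL_timesL (F := unit_graph ty) (e := size (map tr1 Gm))).
  + by rewrite size_edges_strg size_cat /=; lia.
  + by rewrite /elab nth_strg.
  + apply: hl_str dC _.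
    exact: (is_string_subst_strg _ _ _ (ex_intro _ id (string_pos_strg [::]))).
  by have := @wf_sequent_tr1 _ (Gm ++ LOne :: Dl) A (st _); rewrite map_cat.
Qed.

(** * Reading Lambek derivations off graph derivations *)

Lemma map_catI A B (f : A -> B) s t1 t2 : map f s = t1 ++ t2 ->
  exists s1 s2, [/\ s = s1 ++ s2, map f s1 = t1 & map f s2 = t2].
Proof.
move=> e; exists (take (size t1) s), (drop (size t1) s).
by rewrite cat_take_drop map_take map_drop e take_size_cat ?drop_size_cat.
Qed.

Lemma map_consI A B (f : A -> B) s y t : map f s = y :: t ->
  exists x s', [/\ s = x :: s', f x = y & map f s' = t].
Proof. by case: s => // x s' [<- <-]; exists x, s'. Qed.

Lemma glue_labels L (P : graph L) ps : map fst (edges (glue P ps)) = map fst (edges P).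
Proof.
rewrite /glue; elim: ps id P => //= p ps IH f P; rewrite IH /= -map_comp.
by apply: eq_map.
Qed.

Lemma In_filter T (a : pred T) x s : List.In x s -> a x -> List.In x (filter a s).
Proof.
elim: s => //= y s IH [->|/IH h] ax; first by rewrite ax; left.
by case: ifP => _; [right|]; apply: h.
Qed.

Lemma subst_kept L (G : graph L) rs d j : j < size (edges G) -> j \notin unzip1 rs ->
  List.In (nth d (edges G) j).1 (map fst (edges (subst G rs))).
Proof.
move=> hj jr; rewrite /subst; case: subst_aux => -[m es] ps.
rewrite glue_labels map_cat; apply/In_cat; left.
apply: (List.in_map fst); apply: (List.in_map fst _ (nth d (edges G) j, j)).
apply: In_filter => //.
have <- : nth (d, 0) (zip (edges G) (iota 0 (size (edges G)))) j = (nth d (edges G) j, j).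
  by rewrite nth_zip ?size_iota // nth_iota.
by apply: In_nth; rewrite size_zip size_iota minnn.
Qed.

(** The edge [d_0] is never replaced, so its new label survives in the conclusion. If the conclusion
    is a string of translations, [Div N D] is therefore a translation and [D] one of the two
    denominator strings. *)
Lemma divL_label (H : graph ty) N D e Hs : e < size (edges H) ->
  count isNone (edges D) = 1 ->
  List.In (Div N D) (map fst (edges (subst (subst H
    [:: (e, map_lab (fun o => if o is Some t then t else Div N D) D)])
    [seq ((size (edges H)).-1 + j, Hs j) | j <- iota 0 (size (edges D)) & j != didx D]))).
Proof.
move=> he cD; set D' := map_lab _ D; set K := subst H _.
have hD : didx D < size (edges D) by rewrite -has_find has_count cD.
have KL : map fst (edges K) = map fst (rem_at e (edges H)) ++ map fst (edges D').
  rewrite /K subst1E glue_labels map_cat; congr cat.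
  by rewrite /map_att -map_comp; apply: eq_map.
have sK : size (edges K) = (size (edges H)).-1 + size (edges D).
  by rewrite -(size_map fst) KL size_cat !size_map size_rem_at.
have hK : (size (edges H)).-1 + didx D < size (edges K) by rewrite sK ltn_add2l.
have := @subst_kept _ K [seq ((size (edges H)).-1 + j, Hs j)
  | j <- iota 0 (size (edges D)) & j != didx D] (Div N D, [::]) _ hK.
rewrite -(nth_map _ (Div N D)) // KL nth_cat !size_map size_rem_at // ltnNge leq_addr addKn /=.
rewrite -map_comp (nth_map (None, [::])) //=.
have /eqP := nth_find (None, [::]) (etrans (has_count isNone (edges D)) (congr1 (leq 1) cD)).
rewrite -/(didx D) /isNone; case: (nth _ _ _).1 => //= _; apply.
rewrite /unzip1 -map_comp; apply/negP => /mapP[j]; rewrite mem_filter => /andP[/negP jd _] /=.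
by move/addnI => /esym/eqP.
Qed.

Lemma string_label L (G : graph L) w t : is_string G w -> List.In t (map fst (edges G)) -> List.In t w.
Proof.
move=> [f [_ _ _ pm _]] /List.in_map_iff[e [<- ie]].
have /In_path_edges[w1 [x [w2 [-> [-> _]]]]] := Permutation_in _ pm (List.in_map _ _ _ ie).
by apply/In_cat; right; left.
Qed.

(** Stated for every graph that is a string of translations, because the premises come with their
    own node numbering. The type enters through an equation, so that each case can invert [tr1]. *)
Lemma hl_lder H A : hl_der H A -> forall Gamma C, A = tr1 C ->
  is_string H (map tr1 Gamma) -> lder Gamma C.
Proof.
elim=> {H A}.
- move=> p n Gamma [] //= p' [<- en] [f sf].
  have := string_pos_size sf; rewrite size_map; case: Gamma sf => [|X [|Y Ga]] //= sf _.
  case: sf => _ _ _ pm _.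
  have := Permutation_length_1 (pm : Permutation [:: (Prim p n, map f (iota 0 n))] [:: (tr1 X, [:: 0; 1])]).
  move/(congr1 fst) => /= {pm}.
  by case: X => //= q [<- _]; apply: L_ax.
- move=> H A N D e Hs dH IH he hN wfD dHs IHs H' _ Gamma C eA sH'.
  have [wN [okD [cD [aN _]]]] := wfD.
  have [[okH lbH] [_ szH]] := hl_wf dH.
  have /List.in_map_iff[X [eX _]] := string_label sH' (divL_label N Hs he cD).
  have szX : size (ext H) = 2 by rewrite szH eA arity_tr1.
  have [d hd] : exists d, (nth d (edges H) e).1 = N.
    by exists (Prim 0 0, [::]).
  have szA : size (eatt H e) = arity N.
    by rewrite (eattE d he) -(proj2 (lbH _ (In_nth d he))) hd.
  case: X eX => //= [B A'|A' B] [eN eD]; subst N D.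
  + rewrite -eN arity_tr1 in szA.
    have dH0 : hl_der (Hs 0) (tr1 B) by apply: (dHs 0).
    have [[ok0 _] [_ sz0]] := hl_wf dH0; rewrite arity_tr1 in sz0.
    have [w1 [w2 [w3 [ew s1 s2]]]] := is_string_divV (r := false) d okH ok0 he szA sz0 szX sH'.
    rewrite /= cat_rcons in ew.
    have [G1 [G' [-> e1 e2']]] := map_catI ew.
    have [G2 [G'' [-> e2 e3']]] := map_catI e2'.
    have [Y [G3 [-> eY e3]]] := map_consI e3'.
    (* The induction hypotheses ask for equal translations only, so the components of [Y] can stand
       for those of [X]. *)
    case: Y eY => //= B' A'' [eA' eB].
    apply: L_leftL; first by apply: (IHs 0 (tr1 B)) => //; rewrite e2.
    by apply: IH => //; rewrite map_cat /= e1 e3 eA' -hd.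
  + rewrite -eN arity_tr1 in szA.
    have dH0 : hl_der (Hs 1) (tr1 B) by apply: (dHs 1).
    have [[ok0 _] [_ sz0]] := hl_wf dH0; rewrite arity_tr1 in sz0.
    have [w1 [w2 [w3 [ew s1 s2]]]] := is_string_divV (r := true) d okH ok0 he szA sz0 szX sH'.
    have [G1 [G' [-> e1 e2']]] := map_catI ew.
    have [Y [G'' [-> eY e3']]] := map_consI e2'.
    have [G2 [G3 [-> e2 e3]]] := map_catI e3'.
    case: Y eY => //= A'' B' [eA' eB].
    apply: L_rightL; first by apply: (IHs 1 (tr1 B)) => //; rewrite e2.
    by apply: IH => //; rewrite map_cat /= e1 e3 eA' -hd.
- move=> F N D dF IH _ Gamma; case=> //= [A B|B A] [eN eD] sF; subst N D.
  + apply: L_leftR; apply: IH => //=.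
    have := is_string_subst_strg [:: tr1 A] [::] (tr1 B) sF; rewrite cats0; exact.
  apply: L_rightR; apply: IH => //; rewrite map_rcons -cats1.
  exact: (is_string_subst_strg [::] [:: tr1 A] (tr1 B) sF).
- move=> G F A e he eF _ IH _ Gamma C eA [f sf].
  have [w1 [w2 [ew ee _]]] := string_pos_split (Prim 0 0, [::]) sf he.
  rewrite ew in sf.
  have sub u : is_string F u -> is_string (subst G [:: (e, F)]) (w1 ++ u ++ w2).
    by move=> [h sh]; have [f' [sf' _]] := string_pos_subst1 sf he ee sh; exists f'.
  rewrite -/(elab G e) eF in ew.
  have [G1 [G' [-> e1 e2']]] := map_catI ew.
  have [X [G2 [-> eX e2]]] := map_consI e2'.
  (* Only the unit and products translate to [Times]; their graphs are the strings of length 0 and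
     2. *)
  case: X eX => //= [|X Y] [eF']; subst F.
    apply: L_oneL; apply: IH => //; rewrite map_cat e1 e2.
    by apply: (sub [::]); exists id; apply: (string_pos_strg [::]).
  apply: L_prodL; apply: IH => //; rewrite map_cat /= e1 e2.
  by apply: (sub [:: _; _]); exists id; apply: string_pos_strg.
- move=> M Hs dHs IHs G _ Gamma; case=> //= [[eM] sG|A B [eM] sG].
    subst M; case: sG => f /string_pos_size; rewrite size_map.
    by case: Gamma => // _; apply: L_oneR.
  subst M; have d0 := dHs 0 isT; have d1 := dHs 1 isT.
  have [[ok0 _] [_ sz0]] := hl_wf d0; have [[ok1 _] [_ sz1]] := hl_wf d1.
  rewrite !arity_tr1 in sz0 sz1.
  have [w0 [w1 [ew s0 s1]]] := is_string_timesV ok0 ok1 sz0 sz1 sG.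
  have [G0 [G1 [-> e0 e1]]] := map_catI ew.
  by apply: L_prodR; [apply: (IHs 0)|apply: (IHs 1)]; rewrite ?e0 ?e1.
- move=> G G' A dG IH iG Gamma C eA sG; apply: IH => //.
  by apply: is_string_iso iG sG; case: (hl_wf dG) => -[].
Qed.

Theorem theorem4 (Gamma : seq ltype) (C : ltype) :
  lder Gamma C <-> hl_der (strg (map tr1 Gamma)) (tr1 C).
Proof.
split; first exact: lder_hl.
by move/hl_lder; apply=> //; exists id; apply: string_pos_strg.
Qed.
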